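(* There is an algorithm with the following properties. Its input is a shift $\mu\in\mathbb{C}$ and an upper Hessenberg matrix $\hat A\in\mathbb{C}^{N\times N}$, $N=n+k$, given in the factored format $\hat A=L(Q+TZ^H)R$ described in the context, with $R$ proper. It performs one step of the implicitly shifted QR algorithm with shift $\mu$ on $\hat A$, that is, it produces the matrix $\hat A^{(1)}=P^H\hat AP$, where $P=\mathrm{diag}(P_1,I_k)$ is unitary, $P_1\in\mathbb{C}^{n\times n}$, the first column of $P$ is a scalar multiple of $(\hat A-\mu I)e_1$, and $\hat A^{(1)}$ is upper Hessenberg. It returns $\hat A^{(1)}$ in the same factored format, $\hat A^{(1)}=L^{(1)}(Q^{(1)}+T^{(1)}Z^{(1)H})R^{(1)}$. The total number of arithmetic operations is $O(nk)$.
   Context: A matrix $H$ is $k$-upper Hessenberg if $h_{ij}=0$ whenever $i>j+k$, and $k$-lower Hessenberg if $h_{ij}=0$ whenever $j>i+k$; such a matrix is proper if its outermost entries ($h_{j+k,j}$, resp. $h_{j,j+k}$) are all nonzero. A Givens rotation of index $i$ is $I_{i-1}\oplus G\oplus I_{N-i-1}$ with $G$ a $2\times 2$ complex Givens rotation. Factored format. The matrix $\hat A$ has its last $k$ rows equal to zero and its leading $n\times n$ block is a proper upper Hessenberg matrix; it is stored as $\hat A=L(Q+TZ^H)R$ by means of the following data: - $L$ is a proper unitary $k$-lower Hessenberg matrix, stored as $L=L_1\cdots L_k$ with $L_j$ a product of Givens rotations of indices $n+j-1,n+j-2,\dots,j$ (from left to right); - $R$ is a unitary $k$-upper Hessenberg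 matrix, stored as $R=H_k\cdots H_1$ with $H_j$ a product of Givens rotations of indices $j,j+1,\dots,N-1$ (from left to right); - $Q$ is block diagonal with a $k\times k$ unitary diagonal leading block and an $n\times n$ unitary upper Hessenberg trailing block, stored as a product of Givens rotations of indices $k+1,\dots,N-1$ (from left to right) times a unitary diagonal matrix; - $T=\begin{bmatrix}T_k\\0_{n,k}\end{bmatrix}$ with $T_k\in\mathbb{C}^{k\times k}$ nonsingular upper triangular, and $(LT)(n+1:N,:)=-I_k$; - $Z\in\mathbb{C}^{N\times k}$ satisfies $Z^H=L(n+1:N,:)\,Q$.
   Formalization: The leading block of Â^(1) is claimed proper only when μ is not an eigenvalue of the leading block of Â (for n≥2 it cannot be proper otherwise), and the condition on the first column of P is imposed only when (Â−μI)e_1≠0 (it fails only for n=1, Â_11=μ). *)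

(* Defs.v *)
(* Mathematical Components; the complex numbers are R[i] with R : realType. *)
From HB Require Import structures.
From mathcomp Require Import all_boot all_order all_algebra.
From mathcomp Require Export reals complex.
Set Implicit Arguments.
Unset Strict Implicit.
Unset Printing Implicit Defensive.
Import Order.TTheory GRing.Theory Num.Theory.
Local Open Scope ring_scope.
Local Open Scope sesquilinear_scope.

(** * Algorithms

   An algorithm is one closed program [cmd], independent of the sizes n and k
   and of the complex data.  It works on finitely many integer variables (for
   sizes, loop counters and addresses) and on arrays of complex numbers
   indexed by two integers, in exact arithmetic.  No value flows from the
   complex memory to the integer variables except through zero tests. *)

Inductive nexpr : Type :=
| NLit of nat
| NVar of nat
| NAdd of nexpr & nexpr
| NSub of nexpr & nexpr   (* truncated *)
| NMul of nexpr & nexpr.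

(* [CLoc a i j] is the entry (i, j) of array number a.  The only constants
   are the natural numbers. *)
Inductive cexpr : Type :=
| CLit of nat
| CLoc of nat & nexpr & nexpr
| CAdd of cexpr & cexpr
| CSub of cexpr & cexpr
| CMul of cexpr & cexpr
| CDiv of cexpr & cexpr
| CConj of cexpr
| CSqrt of cexpr.

Inductive cmd : Type :=
| Skip
| Seq of cmd & cmd
| NSet of nat & nexpr                     (* integer assignment *)
| CSet of nat & nexpr & nexpr & cexpr     (* a[i, j] := e *)
| IfLeq of nexpr & nexpr & cmd & cmd      (* integer comparison *)
| IfZero of cexpr & cmd & cmd             (* is a complex number zero? *)
| For of nat & nexpr & cmd.               (* for v = 0, ..., e - 1 do c *)

Definition memory (C : Type) := nat -> nat -> nat -> C.

Definition upd_var (s : nat -> nat) (v x : nat) : nat -> nat :=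
  fun w => if w == v then x else s w.

Definition upd_mem (C : Type) (m : memory C) (a i j : nat) (x : C) : memory C :=
  fun a' i' j' => if [&& a' == a, i' == i & j' == j] then x else m a' i' j'.

Fixpoint neval (s : nat -> nat) (e : nexpr) : nat :=
  match e with
  | NLit x => x
  | NVar v => s v
  | NAdd e1 e2 => neval s e1 + neval s e2
  | NSub e1 e2 => neval s e1 - neval s e2
  | NMul e1 e2 => neval s e1 * neval s e2
  end%N.

Fixpoint arith_ops (e : cexpr) : nat :=
  match e with
  | CLit _ | CLoc _ _ _ => 0
  | CAdd e1 e2 | CSub e1 e2 | CMul e1 e2 | CDiv e1 e2 =>
      (arith_ops e1 + arith_ops e2).+1
  | CConj e1 | CSqrt e1 => (arith_ops e1).+1
  end%N.

Section Semantics.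
Variable C : numClosedFieldType.

(* Division by zero, and the square root of anything but a nonnegative real
   number, are run-time errors ([None]). *)
Fixpoint ceval (s : nat -> nat) (m : memory C) (e : cexpr) : option C :=
  let lift2 (f : C -> C -> option C) e1 e2 :=
    obind (fun x => obind (f x) (ceval s m e2)) (ceval s m e1) in
  match e with
  | CLit x => Some x%:R
  | CLoc a i j => Some (m a (neval s i) (neval s j))
  | CAdd e1 e2 => lift2 (fun x y => Some (x + y)) e1 e2
  | CSub e1 e2 => lift2 (fun x y => Some (x - y)) e1 e2
  | CMul e1 e2 => lift2 (fun x y => Some (x * y)) e1 e2
  | CDiv e1 e2 => lift2 (fun x y => if y == 0 then None else Some (x / y)) e1 e2
  | CConj e1 => omap (fun x => x^*) (ceval s m e1)
  | CSqrt e1 =>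
      obind (fun x => if 0 <= x then Some (sqrtC x) else None) (ceval s m e1)
  end.

(* Integer variables, complex memory, and the number of arithmetic operations
   on complex numbers (including conjugations, square roots and zero tests)
   performed so far. *)
Definition state : Type := (nat -> nat) * memory C * nat.

Fixpoint exec (c : cmd) (st : state) {struct c} : option state :=
  let: (s, m, t) := st in
  match c with
  | Skip => Some st
  | Seq c1 c2 => obind (exec c2) (exec c1 st)
  | NSet v e => Some (upd_var s v (neval s e), m, t)
  | CSet a i j e =>
      omap (fun x => (s, upd_mem m a (neval s i) (neval s j) x,
                      (t + arith_ops e)%N)) (ceval s m e)
  | IfLeq e1 e2 c1 c2 =>
      if (neval s e1 <= neval s e2)%N then exec c1 st else exec c2 st
  | IfZero e c1 c2 =>
      obind (fun x => let st' := (s, m, (t + arith_ops e).+1) in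
                      if x == 0 then exec c1 st' else exec c2 st')
            (ceval s m e)
  | For v e body =>
      foldl (fun (ost : option state) (x : nat) =>
               obind (fun st' : state =>
                        let: (s', m', t') := st' in
                        exec body (upd_var s' v x, m', t')) ost)
            (Some st) (iota 0 (neval s e))
  end.

(* Integer variables 0 and 1 initially hold n and k, the others hold 0.  The
   result is the final memory and the number of arithmetic operations. *)
Definition run (c : cmd) (n k : nat) (m : memory C) : option (memory C * nat) :=
  omap (fun st : state => (st.1.2, st.2))
       (exec c (fun v => nth 0%N [:: n; k] v, m, 0%N)).

End Semantics.

(** * Hessenberg matrices *)

Section Format.
Variable C : numClosedFieldType.

Definition upper_hess (k p q : nat) (H : 'M[C]_(p, q)) : Prop :=
  forall (i : 'I_p) (j : 'I_q), (j + k < i)%N -> H i j = 0.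

Definition lower_hess (k p q : nat) (H : 'M[C]_(p, q)) : Prop :=
  forall (i : 'I_p) (j : 'I_q), (i + k < j)%N -> H i j = 0.

Definition proper_upper_hess (k p q : nat) (H : 'M[C]_(p, q)) : Prop :=
  upper_hess k H /\ forall (i : 'I_p) (j : 'I_q), i = (j + k)%N :> nat -> H i j != 0.

Definition proper_lower_hess (k p q : nat) (H : 'M[C]_(p, q)) : Prop :=
  lower_hess k H /\ forall (i : 'I_p) (j : 'I_q), j = (i + k)%N :> nat -> H i j != 0.

(** * Factored format *)

(* I_(i-1) (+) G (+) I_(N-i-1) with G = [c, - s^*; s, c^*]; the index i is
   1-based, the row and column indices a and b are 0-based. *)
Definition givens (N i : nat) (c s : C) : 'M[C]_N :=
  \matrix_(a, b)
    if (a.+1 == i) && (b.+1 == i) then c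
    else if (a.+1 == i) && (b == i :> nat) then - s^*
    else if (a == i :> nat) && (b.+1 == i) then s
    else if (a == i :> nat) && (b == i :> nat) then c^*
    else (a == b)%:R.

Definition is_rotation (c s : C) : Prop := `|c| ^+ 2 + `|s| ^+ 2 = 1.

(* Layout of the memory, all indices being 1-based:
   - array 0, entry (0, 0): the shift mu;
   - arrays 1 and 2, entry (j, i): c and s of the rotation of index i in L_j;
   - arrays 3 and 4, entry (j, i): c and s of the rotation of index i in H_j;
   - arrays 5 and 6, entry (0, i): c and s of the rotation of index i in Q;
   - array 7, entry (0, i): i-th entry of the unitary diagonal factor of Q;
   - array 8: T_k;
   - array 9: Z.
   All other entries are work space, with arbitrary initial content. *)
Section Stored.
Variables (n k : nat) (m : memory C).

Definition stored_shift : C := m 0 0 0.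

Definition stored_Lj (j : nat) : 'M[C]_(n + k) :=
  \prod_(i <- rev (index_iota j (n + j))) givens (n + k) i (m 1 j i) (m 2 j i).

Definition stored_L : 'M[C]_(n + k) := \prod_(1 <= j < k.+1) stored_Lj j.

Definition stored_Hj (j : nat) : 'M[C]_(n + k) :=
  \prod_(j <= i < n + k) givens (n + k) i (m 3 j i) (m 4 j i).

Definition stored_R : 'M[C]_(n + k) :=
  \prod_(j <- rev (index_iota 1 k.+1)) stored_Hj j.

Definition stored_Q : 'M[C]_(n + k) :=
  (\prod_(k.+1 <= i < n + k) givens (n + k) i (m 5 0%N i) (m 6 0%N i))
  *m diag_mx (\row_i m 7 0%N i.+1).

Definition stored_Tk : 'M[C]_k := \matrix_(i, j) m 8 i.+1 j.+1.

Definition stored_T : 'M[C]_(n + k, k) :=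
  castmx (addnC k n, erefl k) (col_mx stored_Tk (0 : 'M[C]_(n, k))).

Definition stored_Z : 'M[C]_(n + k, k) := \matrix_(i, j) m 9 i.+1 j.+1.

Definition stored_rotations : Prop :=
  [/\ forall j i, (1 <= j <= k)%N -> (j <= i <= n + j - 1)%N ->
        is_rotation (m 1 j i) (m 2 j i),
      forall j i, (1 <= j <= k)%N -> (j <= i <= n + k - 1)%N ->
        is_rotation (m 3 j i) (m 4 j i),
      forall i, (k.+1 <= i <= n + k - 1)%N ->
        is_rotation (m 5 0%N i) (m 6 0%N i)
    & forall i, (1 <= i <= n + k)%N -> `|m 7 0%N i| = 1].

(* diag(Qd, Qh), the leading block Qd being k x k *)
Definition Q_structure (Q : 'M[C]_(n + k)) : Prop :=
  exists (Qd : 'M[C]_k) (Qh : 'M[C]_n),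
    [/\ Q = castmx (addnC k n, addnC k n) (block_mx Qd 0 0 Qh),
        Qd \is unitarymx /\ is_diag_mx Qd,
        Qh \is unitarymx & upper_hess 1 Qh].

(* The memory m stores the matrix A as L (Q + T Z^H) R.  Properness of the
   leading block of A, a property of A and not of the stored data, is kept
   apart. *)
Definition factored_format (A : 'M[C]_(n + k)) : Prop :=
  let L := stored_L in let R := stored_R in let Q := stored_Q in
  let T := stored_T in let Z := stored_Z in
  [/\ stored_rotations /\ dsubmx A = 0,
      L \is unitarymx /\ proper_lower_hess k L,
      R \is unitarymx /\ upper_hess k R,
      Q_structure Q /\
      [/\ upper_hess 0 stored_Tk, stored_Tk \in unitmx,
          dsubmx (L *m T) = - 1%:M & Z ^t* = dsubmx L *m Q]
    & A = L *m (Q + T *m Z ^t*) *m R].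

End Stored.

Definition e1 (N : nat) : 'cV[C]_N := \col_i ((i : nat) == 0%N)%:R.

(* A1 = P^H A P with P = diag(P1, I_k) unitary, P e_1 a scalar multiple of
   (A - mu I) e_1, and A1 upper Hessenberg.  When the leading block of A is
   proper, (A - mu I) e_1 vanishes only if n = 1 and A_11 = mu; no unitary P
   satisfies the condition on the first column in that case. *)
Definition qr_step (n k : nat) (mu : C) (A A1 : 'M[C]_(n + k)) : Prop :=
  exists P1 : 'M[C]_n,
    let P : 'M[C]_(n + k) := block_mx P1 0 0 1%:M in
    let x := (A - mu%:M) *m e1 (n + k) in
    [/\ P \is unitarymx,
        x != 0 -> exists alpha : C, P *m e1 (n + k) = alpha *: x,
        A1 = P ^t* *m A *m P
      & upper_hess 1 A1].

End Format.

(* Main.v *)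
(* The pending rotation X, of index k + 1, is chosen so that the adjoint of L X maps
   x = (A - mu) e_1 to a vector supported on its first k + 1 entries; this needs only
   one entry of L, one entry of R and one column of Q, each available in O(k)
   operations.  Then the bulge is chased: X is moved to the left of L, where it
   becomes a rotation G_i of the similarity, the same rotation is moved through R and
   Q back to the right of L, and Z follows.  Every move is a turnover
   G_1 G_2 G_1 = G_2 G_1 G_2 in SU(3), so one sweep costs O(k), and there are n - 1
   sweeps, the last of which is absorbed by Q.

   The identities L(n+1:N, :) T = - I and Z^H = L(n+1:N, :) Q are preserved, and they
   imply all that is asked of the result: the last rows of L F R vanish; L is proper,
   since its lower left block is invertible and L is unitary; and L F R is upper
   Hessenberg, as one sees by back substitution in L^H A = F R.  The vector
   (L X)^H P^H x does not change during the chase, up to rotations that preserve its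
   support, so finally P^H x is a multiple of e_1. *)

Require Import Defs.
From mathcomp Require Import all_boot all_order all_algebra.
From mathcomp Require Import reals complex.
From mathcomp Require Import ring zify.
Set Implicit Arguments.
Unset Strict Implicit.
Unset Printing Implicit Defensive.
Import Order.TTheory GRing.Theory Num.Theory.
Local Open Scope ring_scope.
Local Open Scope sesquilinear_scope.

(** * Turnovers of rotations in C^3 *)

(** Rotations [c, -s^*; s, c^*] run over SU(2). Products, adjoints, reversal of the two coordinates
    and conjugation by a unitary diagonal matrix keep this form, so no phase is ever split off and
    the diagonal factor of Q stays as it is. The obstacle in a turnover is a vector to be
    annihilated that already vanishes, since dividing by its norm would be an error. The turnover is
    therefore stated for any rotation [g1] and any real [r] whose product is that vector; for the
    zero vector [r = 0] and [g1] is free. T is constant during the chase: the rotations that reach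
    it have index above k, and they act on rows where T is zero. Properness of the new leading
    block, for a shift that is not an eigenvalue, comes from a separate argument on the similarity
    alone. The constants of the cost bounds are rounded up: 150 operations for a turnover with its
    copies, 600 k for a sweep. *)

Ltac conj_simpl :=
  rewrite ?(rmorphM, rmorphD, rmorphB, rmorphN, rmorph1, rmorph0) /= ?conjCK.

Section RotationAlgebra.
Variable C : numClosedFieldType.
Implicit Types (g a b c : C * C) (u v w : C * C * C).

Lemma is_rotationE (c s : C) : is_rotation c s <-> c * c^* + s * s^* = 1.
Proof. by rewrite /is_rotation !normCK. Qed.

Definition rot1 g (x y : C) : C := g.1 * x - g.2^* * y.
Definition rot2 g (x y : C) : C := g.2 * x + g.1^* * y.

Definition act12 g u := (rot1 g u.1.1 u.1.2, rot2 g u.1.1 u.1.2, u.2).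
Definition act23 g u := (u.1.1, rot1 g u.1.2 u.2, rot2 g u.1.2 u.2).

Definition rotation g := is_rotation g.1 g.2.
Definition adj g : C * C := (g.1^*, - g.2).
(** Conjugation by the exchange of the two coordinates. It turns a descending pair of indices into
    an ascending one, so a single turnover serves L as well as R and Q. *)
Definition swap g : C * C := (g.1^*, - g.2^*).

Lemma rotation_eq g : rotation g -> g.1 * g.1^* + g.2 * g.2^* = 1.
Proof. by rewrite /rotation is_rotationE. Qed.

Lemma adj_rotation g : rotation g -> rotation (adj g).
Proof. by rewrite /rotation /adj /is_rotation /= norm_conjC normrN. Qed.

Lemma swap_rotation g : rotation g -> rotation (swap g).
Proof. by rewrite /rotation /adj /is_rotation /= normrN !norm_conjC. Qed.

(** The Hermitian product and the determinant [vol] of three columns are the invariants of SU(3);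
    with them the group is handled without 3 x 3 matrices. *)
Definition dot u v : C := u.1.1^* * v.1.1 + u.1.2^* * v.1.2 + u.2^* * v.2.
Definition vol u v w : C :=
  u.1.1 * (v.1.2 * w.2 - v.2 * w.1.2) - u.1.2 * (v.1.1 * w.2 - v.2 * w.1.1)
  + u.2 * (v.1.1 * w.1.2 - v.1.2 * w.1.1).

Definition comb (x y z : C) u v w : C * C * C :=
  (x * u.1.1 + y * v.1.1 + z * w.1.1, x * u.1.2 + y * v.1.2 + z * w.1.2,
   x * u.2 + y * v.2 + z * w.2).

Lemma act12_comb g x y z u v w :
  act12 g (comb x y z u v w) = comb x y z (act12 g u) (act12 g v) (act12 g w).
Proof. by congr (_, _, _); rewrite /= /rot1 /rot2; ring. Qed.

Lemma act23_comb g x y z u v w :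
  act23 g (comb x y z u v w) = comb x y z (act23 g u) (act23 g v) (act23 g w).
Proof. by congr (_, _, _); rewrite /= /rot1 /rot2; ring. Qed.

Lemma dot_act12 g u v : rotation g -> dot (act12 g u) (act12 g v) = dot u v.
Proof.
move=> /rotation_eq g1; rewrite /dot /= /rot1 /rot2; conj_simpl.
transitivity ((g.1 * g.1^* + g.2 * g.2^*) *
   (u.1.1^* * v.1.1 + u.1.2^* * v.1.2) + u.2^* * v.2); first by ring.
by rewrite g1 mul1r.
Qed.

Lemma dot_act23 g u v : rotation g -> dot (act23 g u) (act23 g v) = dot u v.
Proof.
move=> /rotation_eq g1; rewrite /dot /= /rot1 /rot2; conj_simpl.
transitivity ((g.1 * g.1^* + g.2 * g.2^*) *
   (u.1.2^* * v.1.2 + u.2^* * v.2) + u.1.1^* * v.1.1); first by ring.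
by rewrite g1 mul1r; ring.
Qed.

Lemma vol_act12 g u v w :
  rotation g -> vol (act12 g u) (act12 g v) (act12 g w) = vol u v w.
Proof.
move=> /rotation_eq g1; transitivity ((g.1 * g.1^* + g.2 * g.2^*) * vol u v w).
  by rewrite /vol /= /rot1 /rot2; ring.
by rewrite g1 mul1r.
Qed.

Lemma vol_act23 g u v w :
  rotation g -> vol (act23 g u) (act23 g v) (act23 g w) = vol u v w.
Proof.
move=> /rotation_eq g1; transitivity ((g.1 * g.1^* + g.2 * g.2^*) * vol u v w).
  by rewrite /vol /= /rot1 /rot2; ring.
by rewrite g1 mul1r.
Qed.

Lemma act12_adjK g u : rotation g -> act12 g (act12 (adj g) u) = u.
Proof.
move=> /rotation_eq g1; case: u => [[x y] z]; rewrite /act12 /rot1 /rot2 /=.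
conj_simpl; congr (_, _, _).
- transitivity ((g.1 * g.1^* + g.2 * g.2^*) * x); last by rewrite g1 mul1r.
  by ring.
- transitivity ((g.1 * g.1^* + g.2 * g.2^*) * y); last by rewrite g1 mul1r.
  by ring.
Qed.

Lemma act23_adjK g u : rotation g -> act23 g (act23 (adj g) u) = u.
Proof.
move=> /rotation_eq g1; case: u => [[z x] y]; rewrite /act23 /rot1 /rot2 /=.
conj_simpl; congr (_, _, _).
- transitivity ((g.1 * g.1^* + g.2 * g.2^*) * x); last by rewrite g1 mul1r.
  by ring.
- transitivity ((g.1 * g.1^* + g.2 * g.2^*) * y); last by rewrite g1 mul1r.
  by ring.
Qed.

Definition E1 : C * C * C := (1, 0, 0).
Definition E2 : C * C * C := (0, 1, 0).
Definition E3 : C * C * C := (0, 0, 1).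

Lemma comb_basis u : u = comb u.1.1 u.1.2 u.2 E1 E2 E3.
Proof. by case: u => [[x y] z]; congr (_, _, _) => /=; ring. Qed.

(* [E1], [w2], [w3] are the columns of a matrix of SU(3). *)
Lemma su3_first_column w2 w3 :
  dot E1 w2 = 0 -> dot E1 w3 = 0 -> dot w2 w2 = 1 -> dot w2 w3 = 0 ->
  vol E1 w2 w3 = 1 ->
  let g := (w2.1.2, w2.2) in
  [/\ rotation g, w2 = act23 g E2 & w3 = act23 g E3].
Proof.
case: w2 => [[p2 q2] t2]; case: w3 => [[p3 q3] t3]; rewrite /dot /vol /=.
rewrite !(rmorph0, rmorph1) !(mul0r, mul1r, addr0, subr0).
move=> -> -> ; rewrite !mulr0 !add0r => n2 o23 d.
split; first by rewrite /rotation is_rotationE -n2 /=; ring.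
  by congr (_, _, _) => /=; rewrite /rot1 /rot2 /=; ring.
(* Orthogonality to [w2] and the determinant are two linear equations for [w3]; the determinant of
   this system is the squared norm of [w2], which is 1. *)
congr (_, _, _) => /=; rewrite /rot1 /rot2 /=.
  transitivity ((q2^* * q2 + t2^* * t2) * q3); first by rewrite n2 mul1r.
  transitivity (q2 * (q2^* * q3 + t2^* * t3) - t2^* * (q2 * t3 - t2 * q3)).
    by ring.
  by rewrite o23 d; ring.
transitivity ((q2^* * q2 + t2^* * t2) * t3); first by rewrite n2 mul1r.
transitivity (t2 * (q2^* * q3 + t2^* * t3) + q2^* * (q2 * t3 - t2 * q3)).
  by ring.
by rewrite o23 d; ring.
Qed.

(** By the choice of [g1] and [r], the rotations [g1] and [g2] map [E1] to the first column [u] of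
    the product. Removing them from the left leaves an element of SU(3) that fixes [E1], hence a
    rotation of the last two coordinates, and [w] is its second column. *)
Lemma turnover_exists a b c g1 (r : C) :
  rotation a -> rotation b -> rotation c -> rotation g1 -> r^* = r ->
  let u := act12 a (act23 b (act12 c E1)) in
  let v := act12 a (act23 b (act12 c E2)) in
  u.1.2 = g1.1 * r -> u.2 = g1.2 * r ->
  let g2 := (u.1.1, r) in
  let w := act12 (adj g2) (act23 (adj g1) v) in
  let g3 := (w.1.2, w.2) in
  [/\ rotation g2, rotation g3 &
      forall x, act12 a (act23 b (act12 c x)) = act23 g1 (act12 g2 (act23 g3 x))].
Proof.
move=> ra rb rc rg1 rr u v u2 u3 g2 w g3.
have uE : u = act12 a (act23 b (act12 c E1)) by [].
have uu : dot u u = 1.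
  rewrite /u dot_act12 // dot_act23 // dot_act12 // /dot /=.
  by rewrite rmorph1 rmorph0; ring.
move: uE uu u2 u3 @g2 @w @g3; move: u => u uE uu u2 u3 g2 w g3.
have rg2 : rotation g2.
  rewrite /rotation is_rotationE -uu /dot u2 u3 /=; conj_simpl; rewrite rr.
  transitivity (u.1.1 * u.1.1^* +
     (g1.1 * g1.1^* + g1.2 * g1.2^*) * (r * r)); last by ring.
  by rewrite rotation_eq // mul1r.
(* [W] is what remains of the product after the adjoints of [g1] and [g2]. *)
pose W x := act12 (adj g2) (act23 (adj g1) (act12 a (act23 b (act12 c x)))).
have ra1 := adj_rotation rg1; have ra2 := adj_rotation rg2.
have W1 : W E1 = E1.
  rewrite /W -uE [u]surjective_pairing [u.1]surjective_pairing u2 u3.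
  rewrite /act23 /act12 /rot1 /rot2 /=; conj_simpl.
  have := rotation_eq rg2; rewrite /= rr => e2; have e1 := rotation_eq rg1.
  congr (_, _, _).
  - transitivity (u.1.1 * u.1.1^* +
      (g1.1 * g1.1^* + g1.2 * g1.2^*) * (r * r)); last by rewrite e1 mul1r.
    by ring.
  - transitivity (u.1.1 * r * ((g1.1 * g1.1^* + g1.2 * g1.2^*) - 1)).
      by ring.
    by rewrite e1; ring.
  - by ring.
have Wdot x y : dot (W x) (W y) = dot x y.
  by rewrite /W dot_act12 // dot_act23 // dot_act12 // dot_act23 // dot_act12.
have Wvol x y z : vol (W x) (W y) (W z) = vol x y z.
  by rewrite /W vol_act12 // vol_act23 // vol_act12 // vol_act23 // vol_act12.
have [||||| rg3 W2 W3] := @su3_first_column (W E2) (W E3).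
- by rewrite -W1 Wdot /dot /= ?(rmorph0, rmorph1); ring.
- by rewrite -W1 Wdot /dot /= ?(rmorph0, rmorph1); ring.
- by rewrite Wdot /dot /= ?(rmorph0, rmorph1); ring.
- by rewrite Wdot /dot /= ?(rmorph0, rmorph1); ring.
- by rewrite -{1}W1 Wvol /vol /=; ring.
split=> // x.
have -> : act23 g3 x = W x.
  rewrite [x in RHS]comb_basis /W !(act12_comb, act23_comb) -!/(W _) W1 W2 W3.
  rewrite [x in LHS]comb_basis act23_comb; congr comb.
  by congr (_, _, _); rewrite /= /rot1 /rot2 /=; ring.
by rewrite /W act12_adjK // act23_adjK.
Qed.

End RotationAlgebra.

(** * Givens matrices *)

Section Givens.
Variable C : numClosedFieldType.
Implicit Types g a b c : C * C.

(* Column [j] of [M], continued by zero, so that indices are plain naturals. *)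
Definition ent N q (M : 'M[C]_(N, q)) (j : 'I_q) (a : nat) : C :=
  if insub a is Some i then M i j else 0.

Lemma ent_ord N q (M : 'M[C]_(N, q)) j (i : 'I_N) : ent M j i = M i j.
Proof. by rewrite /ent valK. Qed.

Lemma ent_out N q (M : 'M[C]_(N, q)) j (a : nat) : (N <= a)%N -> ent M j a = 0.
Proof. by move=> Na; rewrite /ent insubN // -leqNgt. Qed.

Lemma entP N q (A B : 'M[C]_(N, q)) :
  (forall j (a : nat), ent A j a = ent B j a) -> A = B.
Proof. by move=> AB; apply/matrixP => i j; rewrite -!ent_ord. Qed.

Definition gv N i g : 'M[C]_N := givens N i g.1 g.2.

(** A rotation of 1-based index i mixes the 0-based entries i - 1 and i of each column. The
    commutation and turnover rules for matrices are read off from this formula. *)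
Lemma ent_gv N q i g (M : 'M[C]_(N, q)) j (a : nat) : (0 < i < N)%N ->
  ent (gv N i g *m M) j a =
    if a.+1 == i then rot1 g (ent M j a) (ent M j a.+1)
    else if a == i then rot2 g (ent M j a.-1) (ent M j a) else ent M j a.
Proof.
move=> /andP[i0 iN]; have [aN|Na] := ltnP a N; last first.
  rewrite ent_out //; case: eqP => [?|_]; first lia.
  by case: eqP => [?|_]; [lia | rewrite ent_out].
rewrite -[a]/(nat_of_ord (Ordinal aN)); move: (Ordinal aN) => {aN}a.
rewrite !ent_ord mxE; case: eqP => [ai|ai].
  have aN1 : (a.+1 < N)%N by lia.
  rewrite -[a.+1]/(nat_of_ord (Ordinal aN1)) ent_ord.
  rewrite (bigD1 a) //= (bigD1 (Ordinal aN1)) /=; last first.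
    by rewrite -val_eqE /=; lia.
  rewrite big1 => [|b]; last first.
    rewrite -!val_eqE /= => /andP[/eqP b1 /eqP b2]; rewrite !mxE -?val_eqE /=.
    by do ![case: eqP => ? /=; try lia]; rewrite mul0r.
  rewrite !mxE -?val_eqE /=.
  by do ![case: eqP => ? /=; try lia]; rewrite /rot1 addr0 mulNr.
case: eqP => [ai'|ai'].
  have aN1 : (a.-1 < N)%N by lia.
  rewrite -[a.-1]/(nat_of_ord (Ordinal aN1)) ent_ord.
  rewrite (bigD1 a) //= (bigD1 (Ordinal aN1)) /=; last first.
    by rewrite -val_eqE /=; lia.
  rewrite big1 => [|b]; last first.
    rewrite -!val_eqE /= => /andP[/eqP b1 /eqP b2]; rewrite !mxE -?val_eqE /=.
    by do ![case: eqP => ? /=; try lia]; rewrite mul0r.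
  rewrite !mxE -?val_eqE /=.
  by do ![case: eqP => ? /=; try lia]; rewrite /rot2 addr0 addrC.
rewrite (bigD1 a) //= big1 => [|b]; last first.
  rewrite -!val_eqE /= => /eqP b1; rewrite !mxE -?val_eqE /=.
  by do ![case: eqP => ? /=; try lia]; rewrite ?mul0r.
rewrite !mxE -?val_eqE /=.
by do ![case: eqP => ? /=; try lia]; rewrite addr0 mul1r.
Qed.

Lemma mulmx_ext N (A B : 'M[C]_N) :
  (forall M : 'M[C]_N, A *m M = B *m M) -> A = B.
Proof. by move=> /(_ 1%:M); rewrite !mulmx1. Qed.

Lemma gv_comm N i j g h : (0 < i < N)%N -> (0 < j < N)%N ->
  (i.+1 < j)%N || (j.+1 < i)%N -> gv N i g *m gv N j h = gv N j h *m gv N i g.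
Proof.
move=> iN jN ij; apply: mulmx_ext => M; rewrite -!mulmxA; apply: entP => q a.
by rewrite !ent_gv //; do ![case: eqP => ? /=; try lia].
Qed.

Lemma gv_turnover N p a b c a' b' c' : (0 < p)%N -> (p.+1 < N)%N ->
  (forall x, act12 a (act23 b (act12 c x)) =
             act23 a' (act12 b' (act23 c' x))) ->
  gv N p a *m gv N p.+1 b *m gv N p c =
  gv N p.+1 a' *m gv N p b' *m gv N p.+1 c'.
Proof.
case: p => // p _ pN H; apply: mulmx_ext => M; rewrite -!mulmxA.
apply: entP => q r; rewrite !ent_gv //; try lia.
have := H (ent M q p, ent M q p.+1, ent M q p.+2).
rewrite /act12 /act23 /= => -[H1 H2 H3].
have [rp|rp] := r.+1 =P p.+1.
  by case: rp => ->; do ![case: eqP => ? /=; try lia].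
have [->|rp1] := r =P p.+1.
  by do ![case: eqP => ? /=; try lia].
have [->|rp2] := r =P p.+2.
  by do ![case: eqP => ? /=; try lia].
by do ![case: eqP => ? /=; try lia].
Qed.

Lemma swapK g : swap (swap g) = g.
Proof. by case: g => c s; rewrite /swap /= rmorphN /= !conjCK opprK. Qed.

Lemma rot1_swap g x y : rot1 (swap g) x y = rot2 g y x.
Proof. by rewrite /rot1 /rot2 /=; conj_simpl; ring. Qed.

Lemma rot2_swap g x y : rot2 (swap g) x y = rot1 g y x.
Proof. by rewrite /rot1 /rot2 /=; conj_simpl; ring. Qed.

(** The same turnover with the three coordinates listed in reverse order. *)
Lemma gv_turnover_swap N p a b c a' b' c' : (0 < p)%N -> (p.+1 < N)%N ->
  (forall x, act12 (swap a) (act23 (swap b) (act12 (swap c) x)) =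
             act23 a' (act12 b' (act23 c' x))) ->
  gv N p.+1 a *m gv N p b *m gv N p.+1 c =
  gv N p (swap a') *m gv N p.+1 (swap b') *m gv N p (swap c').
Proof.
case: p => // p _ pN; rewrite -[a']swapK -[b']swapK -[c']swapK.
move: (swap a') (swap b') (swap c') => {}a' {}b' {}c' H; rewrite !swapK.
apply: mulmx_ext => M; rewrite -!mulmxA.
apply: entP => q r; rewrite !ent_gv //; try lia.
have := H (ent M q p.+2, ent M q p.+1, ent M q p).
rewrite /act12 /act23 /= !(rot1_swap, rot2_swap) => -[H1 H2 H3].
have [rp|rp] := r.+1 =P p.+1.
  by case: rp => ->; do ![case: eqP => ? /=; try lia].
have [->|rp1] := r =P p.+1.
  by do ![case: eqP => ? /=; try lia].
have [->|rp2] := r =P p.+2.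
  by do ![case: eqP => ? /=; try lia].
by do ![case: eqP => ? /=; try lia].
Qed.

(** An element of SU(2) is determined by its first column, so the product is the image of the column
    [h] under [g]. *)
Definition rotmul g h : C * C := (rot1 g h.1 h.2, rot2 g h.1 h.2).

Lemma rotmul_rotation g h : rotation g -> rotation h -> rotation (rotmul g h).
Proof.
move=> /rotation_eq g1 /rotation_eq h1; rewrite /rotation is_rotationE /=.
rewrite /rot1 /rot2; conj_simpl.
transitivity ((g.1 * g.1^* + g.2 * g.2^*) * (h.1 * h.1^* + h.2 * h.2^*)).
  by ring.
by rewrite g1 h1 mulr1.
Qed.

Lemma gv_mul N i g h : (0 < i < N)%N -> gv N i g *m gv N i h = gv N i (rotmul g h).
Proof.
move=> iN; apply: mulmx_ext => M; rewrite -!mulmxA; apply: entP => q a.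
rewrite !ent_gv //; case: eqP => [ai|ai].
  by do ![case: eqP => ? /=; try lia]; rewrite /rotmul /rot1 /rot2 /=; conj_simpl; ring.
case: eqP => [ai'|//].
have -> : a.-1.+1 = a by lia.
by do ![case: eqP => ? /=; try lia]; rewrite /rotmul /rot1 /rot2 /=; conj_simpl; ring.
Qed.

Lemma gv_one N i : gv N i (1, 0) = 1%:M :> 'M[C]_N.
Proof.
apply/matrixP => r q; rewrite !mxE /= rmorph0 oppr0 rmorph1 -val_eqE /=.
by do ![case: eqP => ? /=; try lia].
Qed.

Lemma gv_adj N i g : (gv N i g)^t* = gv N i (adj g).
Proof.
apply/matrixP => r q; rewrite !mxE /= -!val_eqE /=.
do ![case: eqP => ? /=; try lia]; conj_simpl;
  by rewrite ?rmorph0 ?rmorph1 ?rmorphN /= ?opprK.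
Qed.

Lemma rotmul_adj g : rotation g -> rotmul g (adj g) = (1, 0).
Proof.
move=> /rotation_eq g1; rewrite /rotmul /rot1 /rot2 /= -g1; conj_simpl.
by congr (_, _); ring.
Qed.

Lemma gv_unitary N i g : (0 < i < N)%N -> rotation g -> gv N i g \is unitarymx.
Proof.
by move=> iN rg; apply/unitarymxP; rewrite gv_adj gv_mul // rotmul_adj // gv_one.
Qed.

(** Conjugation by a unitary diagonal matrix fixes the diagonal of the rotation and multiplies its
    sine by a phase; the result is a rotation again. *)
Lemma diag_gv N i (d : nat -> C) g : (0 < i < N)%N ->
  `|d i| = 1 -> `|d i.+1| = 1 ->
  diag_mx (\row_(r < N) d r.+1) *m gv N i g =
  gv N i (g.1, g.2 * d i.+1 * (d i)^*) *m diag_mx (\row_(r < N) d r.+1).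
Proof.
move=> iN d1 d2; apply/matrixP => r q.
rewrite mul_diag_mx mul_mx_diag !mxE -!val_eqE /=.
have n1 : d i * (d i)^* = 1 by rewrite -normCK d1 expr1n.
have n2 : d i.+1 * (d i.+1)^* = 1 by rewrite -normCK d2 expr1n.
have [ri|ri] := r.+1 =P i; have [qi|qi] := q.+1 =P i => /=.
- by rewrite ri qi mulrC.
- case: eqP => qi' /=.
    rewrite ri qi' ; conj_simpl.
    transitivity (- (g.2^* * d i) * (d i.+1 * (d i.+1)^*)); last by ring.
    by rewrite n2; ring.
  by do ![case: eqP => ? /=; try lia]; rewrite !(mulr0, mul0r).
- case: eqP => ri' /=.
    rewrite ri' qi.
    transitivity (g.2 * d i.+1 * (d i * (d i)^*)); last by ring.
    by rewrite n1; ring.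
  by do ![case: eqP => ? /=; try lia]; rewrite !(mulr0, mul0r).
- do ![case: eqP => ? /=; try lia]; rewrite ?(mulr0, mul0r) //.
    by (have -> : r = q :> nat by lia); rewrite mulrC.
  by (have -> : r = q :> nat by lia); rewrite mulrC.
Qed.

Lemma gv_block n k i g : (0 < i < n)%N ->
  gv (n + k) i g = block_mx (gv n i g) 0 0 1%:M.
Proof.
move=> iN; apply/matrixP => r q.
rewrite -(splitK r) -(splitK q); case: (split r) => r'; case: (split q) => q' /=;
 rewrite ?(block_mxEul, block_mxEur, block_mxEdl, block_mxEdr) !mxE /= -!val_eqE /=;
 have := ltn_ord r'; have := ltn_ord q'; move=> ? ?;
 by do ![case: eqP => ? /=; try lia].
Qed.

Definition rowprod N (l : seq nat) (cs ss : nat -> C) : 'M[C]_N :=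
  \prod_(i <- l) gv N i (cs i, ss i).

Lemma rowprod_cat N l1 l2 cs ss :
  rowprod N (l1 ++ l2) cs ss = rowprod N l1 cs ss *m rowprod N l2 cs ss.
Proof. exact: big_cat. Qed.

Lemma rowprod_cons N i l cs ss :
  rowprod N (i :: l) cs ss = gv N i (cs i, ss i) *m rowprod N l cs ss.
Proof. exact: big_cons. Qed.

Lemma rowprod_nil N cs ss : rowprod N [::] cs ss = 1%:M.
Proof. exact: big_nil. Qed.

Lemma eq_rowprod N l cs ss cs' ss' :
  {in l, cs =1 cs'} -> {in l, ss =1 ss'} ->
  rowprod N l cs ss = rowprod N l cs' ss'.
Proof. by move=> ec es; apply: eq_big_seq => i il; rewrite ec // es. Qed.

Lemma rowprod_unitary N l cs ss :
  {in l, forall i, (0 < i < N)%N /\ rotation (cs i, ss i)} ->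
  rowprod N l cs ss \is unitarymx.
Proof.
elim: l => [|i l IH] H.
  by rewrite rowprod_nil; apply/unitarymxP; rewrite mul1mx trmx1 map_mx1.
have [iN ri] := H i (mem_head i l).
rewrite rowprod_cons mul_unitarymx // ?gv_unitary // IH // => j jl.
by apply: H; rewrite inE jl orbT.
Qed.

Lemma rowprod_comm N l q g cs ss : (0 < q < N)%N ->
  {in l, forall i, (0 < i < N)%N && ((i.+1 < q)%N || (q.+1 < i)%N)} ->
  rowprod N l cs ss *m gv N q g = gv N q g *m rowprod N l cs ss.
Proof.
move=> qN; elim: l => [|i l IH] H; first by rewrite rowprod_nil mul1mx mulmx1.
have /andP[iN iq] := H i (mem_head i l).
rewrite rowprod_cons -mulmxA IH; last first.
  by move=> j jl; apply: H; rewrite inE jl orbT.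
by rewrite !mulmxA (gv_comm _ _ iN qN).
Qed.

(** The rotation entering from the right commutes with [l2], undergoes one turnover with the two
    adjacent factors, and leaves past [l1] with the other index. Ascending and descending products
    are both covered. *)
Lemma rowprod_pass N l1 l2 q1 q2 cs ss cs' ss' x y :
  (0 < q1 < N)%N -> (0 < q2 < N)%N ->
  {in l1, forall i, (0 < i < N)%N && ((i.+1 < q2)%N || (q2.+1 < i)%N)} ->
  {in l2, forall i, (0 < i < N)%N && ((i.+1 < q1)%N || (q1.+1 < i)%N)} ->
  {in l1 ++ l2, cs =1 cs'} -> {in l1 ++ l2, ss =1 ss'} ->
  gv N q1 (cs q1, ss q1) *m gv N q2 (cs q2, ss q2) *m gv N q1 x =
  gv N q2 y *m gv N q1 (cs' q1, ss' q1) *m gv N q2 (cs' q2, ss' q2) ->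
  rowprod N (l1 ++ q1 :: q2 :: l2) cs ss *m gv N q1 x =
  gv N q2 y *m rowprod N (l1 ++ q1 :: q2 :: l2) cs' ss'.
Proof.
move=> q1N q2N H1 H2 ec es t; rewrite !rowprod_cat !rowprod_cons.
rewrite -!mulmxA (rowprod_comm x cs ss q1N H2).
rewrite [in RHS]mulmxA -(rowprod_comm y cs' ss' q2N H1).
rewrite (@eq_rowprod _ l1 cs ss cs' ss') ?(@eq_rowprod _ l2 cs ss cs' ss').
- by rewrite -!mulmxA; congr (_ *m _); rewrite !mulmxA t.
- by move=> i il; apply: ec; rewrite mem_cat il orbT.
- by move=> i il; apply: es; rewrite mem_cat il orbT.
- by move=> i il; apply: ec; rewrite mem_cat il.
- by move=> i il; apply: es; rewrite mem_cat il.
Qed.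

End Givens.

(** * Hessenberg matrices and the factored format *)

Section Hessenberg.
Variable C : numClosedFieldType.

Lemma trmxC_mul p q r (A : 'M[C]_(p, q)) (B : 'M[C]_(q, r)) :
  (A *m B)^t* = B^t* *m A^t*.
Proof. by rewrite trmx_mul map_mxM. Qed.

Lemma trmxC_inv p q (A : 'M[C]_(p, q)) : A^t*^t* = A.
Proof. by apply/matrixP => i j; rewrite !mxE conjCK. Qed.

Lemma trmxC1 p : (1%:M : 'M[C]_p)^t* = 1%:M.
Proof. by rewrite trmx1 map_mx1. Qed.

Lemma unitary_adjr p (U : 'M[C]_p) : U \is unitarymx -> U *m U^t* = 1%:M.
Proof. by move=> /unitarymxP. Qed.

Lemma unitary_adjl p (U : 'M[C]_p) : U \is unitarymx -> U^t* *m U = 1%:M.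
Proof. by rewrite -trmxC_unitary => /unitarymxP; rewrite trmxC_inv. Qed.

Lemma entD N q (A B : 'M[C]_(N, q)) j a : ent (A + B) j a = ent A j a + ent B j a.
Proof. by rewrite /ent; case: insub => [i|]; rewrite ?mxE ?addr0. Qed.

Lemma entB N q (A B : 'M[C]_(N, q)) j a : ent (A - B) j a = ent A j a - ent B j a.
Proof. by rewrite /ent; case: insub => [i|]; rewrite ?mxE ?subr0. Qed.

Lemma entZ N q x (A : 'M[C]_(N, q)) j a : ent (x *: A) j a = x * ent A j a.
Proof. by rewrite /ent; case: insub => [i|]; rewrite ?mxE ?mulr0. Qed.

Lemma ent_diag N q (f : nat -> C) (M : 'M[C]_(N, q)) j a :
  ent (diag_mx (\row_r f r.+1) *m M) j a = f a.+1 * ent M j a.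
Proof.
rewrite /ent; case: insubP => [i _ <-|_]; last by rewrite mulr0.
by rewrite mul_diag_mx !mxE.
Qed.

Lemma ent1 N (j : 'I_N) (a : nat) : ent (1%:M : 'M[C]_N) j a = (a == j)%:R.
Proof.
rewrite /ent; case: insubP => [i _ <-|]; first by rewrite mxE.
by rewrite -leqNgt; case: eqP => // ->; rewrite leqNgt ltn_ord.
Qed.

Lemma ent_e1 N a : (0 < N)%N -> ent (@e1 C N) ord0 a = (a == 0%N)%:R.
Proof.
move=> N0; rewrite /ent; case: insubP => [i _ <-|]; first by rewrite mxE.
by case: eqP => // ->; rewrite N0.
Qed.

Definition supp (d : nat) (v : nat -> C) := forall a, (d < a)%N -> v a = 0.

Lemma supp_upper_hess p N (M : 'M[C]_N) :
  (forall j : 'I_N, supp (j + p) (ent M j)) <-> upper_hess p M.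
Proof.
split=> H => [i j ij|j a ja]; first by rewrite -ent_ord H.
by rewrite /ent; case: insubP => // i _ ia; apply: H; rewrite ia.
Qed.

Lemma rowprod_above N l cs ss q (M : 'M[C]_(N, q)) j d :
  {in l, forall i, (d.+1 < i < N)%N} -> supp d (ent M j) ->
  ent (rowprod N l cs ss *m M) j =1 ent M j.
Proof.
move=> + sM; elim: l => [|i l IH] H a; first by rewrite rowprod_nil mul1mx.
have /andP[di iN] := H i (mem_head i l).
have IH' : ent (rowprod N l cs ss *m M) j =1 ent M j.
  by apply: IH => i' il; apply: H; rewrite inE il orbT.
rewrite rowprod_cons -mulmxA ent_gv ?(ltn_trans _ di) //= !IH'.
case: eqP => [ai|_]; first by rewrite /rot1 !sM ?mulr0 ?subr0 //; lia.
case: eqP => [ai|//]; rewrite /rot2 !(sM a, sM a.-1) ?mulr0 ?addr0 //; lia.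
Qed.

Lemma rowprod_below N l cs ss q (M : 'M[C]_(N, q)) j d :
  {in l, forall i, (0 < i < N)%N && (i <= d)%N} -> supp d (ent M j) ->
  supp d (ent (rowprod N l cs ss *m M) j).
Proof.
move=> + sM; elim: l => [|i l IH] H a da; first by rewrite rowprod_nil mul1mx sM.
have /andP[iN id] := H i (mem_head i l).
rewrite rowprod_cons -mulmxA ent_gv //=.
have IH' : supp d (ent (rowprod N l cs ss *m M) j).
  by apply: IH => i' il; apply: H; rewrite inE il orbT.
by do 2!(case: eqP => [?|_]; first lia); rewrite IH'.
Qed.

Lemma index_iota_cat l m h : (l <= m <= h)%N ->
  index_iota l h = index_iota l m ++ index_iota m h.
Proof.
move=> lmh; rewrite /index_iota; have -> : (h - l = (m - l) + (h - m))%N by lia.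
by rewrite iotaD; congr (_ ++ iota _ _); lia.
Qed.

Lemma index_iota_cons l h : (l < h)%N -> index_iota l h = l :: index_iota l.+1 h.
Proof.
by move=> lh; rewrite /index_iota; have -> : (h - l = (h - l.+1).+1)%N by lia.
Qed.

(** The factors of index at least d + 2 act first and see only zeros; those of index at most d + 1
    reach no further than the entry d + 1. The product is cut at [m] between the two kinds. *)
Lemma rowprod_asc_supp N l h cs ss q (M : 'M[C]_(N, q)) j d :
  (0 < l)%N -> (h <= N)%N -> supp d (ent M j) ->
  supp d.+1 (ent (rowprod N (index_iota l h) cs ss *m M) j).
Proof.
move=> l0 hN sM; have [hl|lh] := leqP h l.
  rewrite /index_iota (eqP hl) rowprod_nil mul1mx => a da; apply: sM; lia.
pose m := minn h (maxn l d.+2).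
rewrite (@index_iota_cat l m h) ?rowprod_cat -?mulmxA; last by rewrite /m; lia.
apply: rowprod_below => [i|a da]; first by rewrite mem_index_iota /m; lia.
rewrite (rowprod_above _ _ _ sM) ?sM //; first by lia.
by move=> i; rewrite mem_index_iota /m; lia.
Qed.

(** When the product starts exactly at index d + 1, its first factor alone acts on the last nonzero
    entry. *)
Lemma rowprod_asc_entries N h cs ss q (M : 'M[C]_(N, q)) j d :
  (d.+1 < h)%N -> (h <= N)%N -> supp d (ent M j) ->
  let v := ent (rowprod N (index_iota d.+1 h) cs ss *m M) j in
  [/\ v d = cs d.+1 * ent M j d, v d.+1 = ss d.+1 * ent M j d & supp d.+1 v].
Proof.
move=> dh hN sM v; split; last by apply: rowprod_asc_supp.
  rewrite /v index_iota_cons // rowprod_cons -mulmxA ent_gv ?(leq_trans dh) //.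
  rewrite eqxx !(rowprod_above _ _ _ sM) /rot1 /= ?(sM d.+1) ?mulr0 ?subr0 //;
    by move=> i; rewrite mem_index_iota; lia.
rewrite /v index_iota_cons // rowprod_cons -mulmxA ent_gv ?(leq_trans dh) //.
case: eqP => [|_]; first lia.
rewrite eqxx !(rowprod_above _ _ _ sM) /rot2 /= ?(sM d.+1) ?mulr0 ?addr0 //;
  by move=> i; rewrite mem_index_iota; lia.
Qed.

(* [hi j = N] for R, and [hi j = n + j] for the adjoint of L. *)
Definition Hprod N k (hi : nat -> nat) (cs ss : nat -> nat -> C) : 'M[C]_N :=
  \prod_(j <- rev (index_iota 1 k.+1))
     rowprod N (index_iota j (hi j)) (cs j) (ss j).

Lemma Hprod0 N hi cs ss : Hprod N 0 hi cs ss = 1%:M.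
Proof. exact: big_nil. Qed.

Lemma HprodS N k hi cs ss : Hprod N k.+1 hi cs ss =
  rowprod N (index_iota k.+1 (hi k.+1)) (cs k.+1) (ss k.+1) *m Hprod N k hi cs ss.
Proof.
rewrite /Hprod (@index_iota_cat 1 k.+1 k.+2); last by lia.
by rewrite rev_cat (index_iota_cons (ltnSn k.+1)) {1}/index_iota subnn big_cons.
Qed.

Lemma Hprod_supp N k hi cs ss q (M : 'M[C]_(N, q)) j d :
  (forall i, (0 < i <= k)%N -> (hi i <= N)%N) -> supp d (ent M j) ->
  supp (d + k) (ent (Hprod N k hi cs ss *m M) j).
Proof.
move=> + sM; elim: k => [|k IH] H; first by rewrite Hprod0 mul1mx addn0.
rewrite HprodS -mulmxA addnS; apply: rowprod_asc_supp => //; first by apply: H; lia.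
by apply: IH => i ik; apply: H; lia.
Qed.

Lemma Hprod_upper_hess N k hi cs ss :
  (forall i, (0 < i <= k)%N -> (hi i <= N)%N) -> upper_hess k (Hprod N k hi cs ss).
Proof.
move=> H; apply/supp_upper_hess => j; rewrite -[Hprod _ _ _ _ _]mulmx1.
by apply: Hprod_supp => // a ja; rewrite ent1; case: eqP => //; lia.
Qed.

(** Each line lengthens the support by one, and the new last entry is the old one times the sine of
    the first rotation of that line. This is why one entry of L or R costs only O(k) operations. *)
Lemma Hprod_entry N k hi cs ss q (M : 'M[C]_(N, q)) j :
  (forall i, (0 < i <= k)%N -> (i < hi i <= N)%N) -> supp 0 (ent M j) ->
  ent (Hprod N k hi cs ss *m M) j k = (\prod_(1 <= i < k.+1) ss i i) * ent M j 0%N.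
Proof.
move=> + sM; elim: k => [|k IH] H; first by rewrite Hprod0 mul1mx big_nil mul1r.
rewrite HprodS -mulmxA.
have sk : supp k (ent (Hprod N k hi cs ss *m M) j).
  apply: (@Hprod_supp _ _ _ _ _ _ _ _ 0) => // i ik.
  by have /andP[] : (i < hi i <= N)%N by apply: H; lia.
have /andP[h1 h2] : (k.+1 < hi k.+1 <= N)%N by apply: H; lia.
have [_ -> _] := rowprod_asc_entries (cs k.+1) (ss k.+1) h1 h2 sk.
rewrite IH => [|i ik]; last by apply: H; lia.
by rewrite [in RHS]big_nat_recr //= mulrA; congr (_ * _); rewrite mulrC.
Qed.

Lemma rowprod_adj N l (cs ss : nat -> C) : (rowprod N l cs ss)^t* =
  rowprod N (rev l) (fun i => (cs i)^*) (fun i => - ss i).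
Proof.
elim: l => [|i l IH]; first by rewrite !rowprod_nil trmxC1.
rewrite rowprod_cons trmxC_mul IH rev_cons -cats1 rowprod_cat; congr (_ *m _).
by rewrite rowprod_cons rowprod_nil mulmx1 gv_adj.
Qed.

Lemma Hprod_unitary N k hi cs ss :
  (forall j i, (0 < j <= k)%N -> (j <= i < hi j)%N ->
     (i < N)%N /\ rotation (cs j i, ss j i)) ->
  Hprod N k hi cs ss \is unitarymx.
Proof.
elim: k => [|k IH] H; first by rewrite Hprod0; apply/unitarymxP; rewrite mul1mx trmxC1.
rewrite HprodS mul_unitarymx //; last by apply: IH => j i jk; apply: H; lia.
apply: rowprod_unitary => i; rewrite mem_index_iota => ik.
have [] := H k.+1 i _ ik; first lia.
by move=> iN ri; split=> //; lia.
Qed.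

(** The adjoint of L has the same shape as R, with shorter lines, so the facts on [Hprod] serve
    both. *)
Lemma stored_L_adj n k (m : memory C) : (stored_L n k m)^t* =
  Hprod (n + k) k (fun j => (n + j)%N) (fun j i => (m 1%N j i)^*)
    (fun j i => - m 2%N j i).
Proof.
rewrite /stored_L /Hprod; elim: (index_iota 1 k.+1) => [|j l IH].
  by rewrite !big_nil trmxC1.
rewrite big_cons [LHS]trmxC_mul IH rev_cons -cats1 big_cat; congr (_ *m _).
rewrite big_cons big_nil [RHS]mulmx1.
by rewrite -[stored_Lj _ _ _ _]/(rowprod _ _ _ _) rowprod_adj revK.
Qed.

End Hessenberg.

Section Format.
Variables (C : numClosedFieldType) (n k : nat).
Implicit Types (L Q R : 'M[C]_(n + k)) (m : memory C).

(** Q and T are cut after k rows, but A after n rows. [ord_k] and [ord_n] are the indices of the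
    first cut inside ['I_(n + k)]. *)
Definition ord_k (j : 'I_k) : 'I_(n + k) := cast_ord (addnC k n) (lshift n j).
Definition ord_n (j : 'I_n) : 'I_(n + k) := cast_ord (addnC k n) (rshift k j).

Variant ord_spec : 'I_(n + k) -> Prop :=
| OrdK j : ord_spec (ord_k j)
| OrdN j : ord_spec (ord_n j).

Lemma ordP i : ord_spec i.
Proof.
rewrite -(cast_ordKV (addnC k n) i) -(splitK (cast_ord (esym (addnC k n)) i)).
by case: (split _) => j /=; [apply: OrdK | apply: OrdN].
Qed.

Lemma castmx_unitary p q (e : p = q) (A : 'M[C]_p) :
  (castmx (e, e) A \is unitarymx) = (A \is unitarymx).
Proof. by case: q / e; rewrite castmx_id. Qed.

Lemma stored_TE m (a : 'I_(n + k)) (j : 'I_k) :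
  stored_T n k m a j = if (a < k)%N then m 8 a.+1 j.+1 else 0.
Proof.
rewrite /stored_T castmxE /= cast_ord_id; case: (ordP a) => i /=.
  by rewrite cast_ordK col_mxEu mxE ltn_ord.
by rewrite cast_ordK col_mxEd mxE ltnNge leq_addr.
Qed.

Lemma ent_TM m q (W : 'M[C]_(k, q)) j a :
  (k <= a)%N -> ent (stored_T n k m *m W) j a = 0.
Proof.
move=> ka; rewrite /ent; case: insubP => // i _ ia; rewrite mxE big1 // => b _.
by rewrite stored_TE ia ltnNge ka mul0r.
Qed.

Lemma stored_QE m : stored_Q n k m =
  rowprod (n + k) (index_iota k.+1 (n + k)) (m 5 0%N) (m 6 0%N)
  *m diag_mx (\row_i m 7 0%N i.+1).
Proof. by []. Qed.

Lemma stored_RE m :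
  stored_R n k m = Hprod (n + k) k (fun _ => (n + k)%N) (m 3) (m 4).
Proof. by []. Qed.

Section Rotations.
Variable m : memory C.
Hypothesis rm : stored_rotations n k m.

Lemma stored_R_unitary : stored_R n k m \is unitarymx.
Proof.
case: rm => _ rH _ _; rewrite stored_RE; apply: Hprod_unitary => j i jk ij.
by split; [lia | apply: rH; lia].
Qed.

Lemma stored_L_unitary : stored_L n k m \is unitarymx.
Proof.
case: rm => rL _ _ _; rewrite -trmxC_unitary stored_L_adj.
apply: Hprod_unitary => j i jk ij; split; first lia.
by apply: (@adj_rotation _ (_, _)); apply: rL; lia.
Qed.

Lemma stored_R_hess : upper_hess k (stored_R n k m).
Proof. by rewrite stored_RE; apply: Hprod_upper_hess. Qed.

Lemma stored_L_adj_hess : upper_hess k ((stored_L n k m)^t*).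
Proof. by rewrite stored_L_adj; apply: Hprod_upper_hess => i ik; lia. Qed.

Lemma stored_L_hess : lower_hess k (stored_L n k m).
Proof.
move=> i j ij; have := stored_L_adj_hess ij; rewrite !mxE => /eqP.
by rewrite conjC_eq0 => /eqP.
Qed.

Lemma stored_Q_unitary : stored_Q n k m \is unitarymx.
Proof.
case: rm => _ _ rQ rD; rewrite stored_QE mul_unitarymx //.
  apply: rowprod_unitary => i; rewrite mem_index_iota => ik.
  by split; [lia | apply: rQ; lia].
apply/unitarymxP/matrixP => i j; rewrite mul_diag_mx !mxE eq_sym.
have [->|ij] := eqVneq i j; last by rewrite rmorph0 mulr0.
by rewrite !mulr1n -normCK rD ?expr1n //; have := ltn_ord j; lia.
Qed.

Lemma stored_Q_supp q (M : 'M[C]_(n + k, q)) j d :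
  supp d (ent M j) -> supp d.+1 (ent (stored_Q n k m *m M) j).
Proof.
move=> sM; rewrite stored_QE -mulmxA; apply: rowprod_asc_supp => // a da.
by rewrite ent_diag sM ?mulr0.
Qed.

Lemma stored_Q_hess : upper_hess 1 (stored_Q n k m).
Proof.
apply/supp_upper_hess => j; rewrite -[stored_Q _ _ _]mulmx1 addn1.
by apply: stored_Q_supp => a ja; rewrite ent1; case: eqP => //; lia.
Qed.

Lemma stored_Q_leading (i j : 'I_(n + k)) : (i < k)%N || (j < k)%N ->
  stored_Q n k m i j = m 7 0%N i.+1 *+ (i == j :> nat).
Proof.
rewrite -ent_ord stored_QE -[diag_mx _]mulmx1.
set D := _ *m 1%:M => ijk.
have DE a : ent D j a = m 7 0%N a.+1 * (a == j)%:R.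
  by rewrite /D (@ent_diag _ _ _ (m 7 0%N)) ent1.
have <- : ent D j i = m 7 0%N i.+1 *+ (i == j :> nat) by rewrite DE mulr_natr.
have [jk|kj] := ltnP j k.
  apply: (@rowprod_above _ _ _ _ _ _ _ _ j) => [a|a ja].
    by rewrite mem_index_iota; lia.
  by rewrite DE; case: eqP => ?; [lia | rewrite mulr0].
(* In a row i < k: all factors have index above k, so none of them touches the entry i. *)
move: (index_iota _ _) (mem_index_iota k.+1 (n + k)) => l Hl.
have {}Hl : {in l, forall a, (i.+1 < a < n + k)%N} by move=> a; rewrite Hl; lia.
elim: l Hl => [|a l IH] Hl; first by rewrite rowprod_nil mul1mx.
have /andP[ia aN] := Hl a (mem_head a l).
rewrite rowprod_cons -mulmxA ent_gv; last by lia.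
do 2!(case: eqP => [?|_]; first lia).
by apply: IH => b bl; apply: Hl; rewrite inE bl orbT.
Qed.

Lemma stored_Q_structure : Q_structure (stored_Q n k m).
Proof.
pose Qd : 'M[C]_k := diag_mx (\row_i m 7 0%N i.+1).
pose Qh : 'M[C]_n := \matrix_(i, j) stored_Q n k m (ord_n i) (ord_n j).
have QE : stored_Q n k m = castmx (addnC k n, addnC k n) (block_mx Qd 0 0 Qh).
  apply/matrixP => i j; rewrite castmxE.
  case: (ordP i) => i'; case: (ordP j) => j'; rewrite /= !cast_ordK.
  - by rewrite block_mxEul stored_Q_leading ?mxE //= ltn_ord.
  - rewrite block_mxEur [RHS]mxE stored_Q_leading /= ?ltn_ord //.
    by case: eqP => // ij; have := ltn_ord i'; lia.
  - rewrite block_mxEdl [RHS]mxE stored_Q_leading /= ?ltn_ord ?orbT //.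
    by case: eqP => // ij; have := ltn_ord j'; lia.
  - by rewrite block_mxEdr [RHS]mxE.
have := stored_Q_unitary; rewrite QE castmx_unitary => /unitarymxP.
rewrite tr_block_mx map_block_mx !trmx0 !map_mx0 mulmx_block.
rewrite !(mulmx0, mul0mx, addr0, add0r) scalar_mx_block => /eq_block_mx[Ud _ _ Uh].
exists Qd, Qh; split => //.
- by split; [apply/unitarymxP | apply: diag_mx_is_diag].
- exact/unitarymxP.
- by move=> i j ij; rewrite mxE stored_Q_hess //=; lia.
Qed.

End Rotations.

(** Equation k + a of [L^t* *m y] involves only the entries of y from a on, and the coefficient of
    the entry a is an outermost entry of L. Descending from a = n - 1, the entries vanish one after
    the other. This is used for the columns of A and for the vector P^H x. *)
Lemma backsubstitution L q (y : 'M[C]_(n + k, q)) b d :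
  lower_hess k L ->
  (forall i j : 'I_(n + k), j = (i + k)%N :> nat -> L i j != 0) ->
  (forall a, (n <= a)%N -> ent y b a = 0) ->
  (forall a, (d < a < n)%N -> ent (L^t* *m y) b (k + a)%N = 0) ->
  supp d (ent y b).
Proof.
move=> lL pL yn Ly a da.
have [t] := ubnP (n - a); elim: t a da => // t IH a da nat.
have [an|na] := ltnP a n; last exact: yn.
have kaN : (k + a < n + k)%N by lia.
have aN : (a < n + k)%N by lia.
have := Ly a; rewrite da an => /(_ isT).
rewrite -[(k + a)%N]/(nat_of_ord (Ordinal kaN)) ent_ord mxE.
rewrite (bigD1 (Ordinal aN)) //= big1 => [|i].
  rewrite addr0 !mxE => /eqP; rewrite mulf_eq0 conjC_eq0 -[y _ b]ent_ord /=.
  by rewrite (negPf (pL _ _ _)) /= 1?addnC // => /eqP.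
rewrite -val_eqE /= !mxE => ia; have [ia'|ai] := ltnP i a.
  by rewrite lL ?rmorph0 ?mul0r //=; lia.
by rewrite -[y i b]ent_ord IH ?mulr0 //; lia.
Qed.

(* The blocks satisfy L21 T_k = -1, so L21 is invertible; as L is unitary, the
   complementary block L12, which is triangular, is invertible too. *)
Lemma proper_of_dsub L m : L \is unitarymx -> lower_hess k L ->
  dsubmx (L *m stored_T n k m) = - 1%:M -> proper_lower_hess k L.
Proof.
move=> uL lL LT; split=> // i j ij.
pose e := addnC n k.
(* The columns are regrouped as k + n, which makes [L12] and [L21] square. *)
pose B : 'M[C]_(n + k, k + n) := castmx (erefl, e) L.
have BE r s : B r s = L r (cast_ord (esym e) s) by rewrite castmxE cast_ord_id.
pose L11 := ulsubmx B; pose L12 := ursubmx B.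
pose L21 := dlsubmx B; pose L22 := drsubmx B.
have BB : B *m B^t* = 1%:M.
  move/unitarymxP: uL => <-; apply/matrixP => r s; rewrite !mxE.
  rewrite (reindex (cast_ord e)) /=; last first.
    by exists (cast_ord (esym e)) => x _; rewrite ?cast_ordK ?cast_ordKV.
  by apply: eq_bigr => x _; rewrite !mxE !BE cast_ordK.
have L21T : L21 *m stored_Tk k m = - 1%:M.
  rewrite -LT; apply/matrixP => r s; rewrite !mxE.
  rewrite (reindex (cast_ord (addnC k n))) /=; last first.
    by exists (cast_ord (esym (addnC k n))) => x _; rewrite ?cast_ordK ?cast_ordKV.
  rewrite big_split_ord /= [X in _ = _ + X]big1 => [|x _]; last first.
    by rewrite stored_TE /= ltnNge leq_addr mulr0.
  rewrite addr0; apply: eq_bigr => x _.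
  rewrite stored_TE /= ltn_ord !mxE BE; congr (L _ _ * _).
  by apply: val_inj.
have uL21 : L21 \in unitmx.
  have : L21 *m (- stored_Tk k m) = 1%:M by rewrite mulmxN L21T opprK.
  by case/mulmx1_unit.
have dL12 : \det L12 != 0.
  (* If v L12 = 0, unitarity gives (v, 0) = (v L11, 0) B^H. The second block says v L11 L21^H = 0,
     hence v L11 = 0, and then the first block says v = 0. *)
  apply/negP => /det0P[v v0 vL].
  have vB : row_mx v 0 *m B = row_mx (v *m L11) 0.
    by rewrite -[B]submxK mul_row_block vL !mul0mx !addr0.
  have : row_mx v 0 = row_mx (v *m L11) 0 *m B^t*.
    by rewrite -vB -mulmxA BB mulmx1.
  rewrite -[B]submxK tr_block_mx map_block_mx mul_row_block !mul0mx !addr0.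
  case/eq_row_mx => vE /esym /(congr1 (mulmx^~ (invmx (L21^t*)))).
  rewrite mulmxK ?mul0mx ?unitmx_tr ?map_unitmx ?unitmx_tr // => v11.
  by move: v0; rewrite vE v11 mul0mx eqxx.
(* The diagonal entries of this triangular block are the outermost entries of L. *)
have trig : is_trig_mx L12.
  apply/is_trig_mxP => r s rs; rewrite !mxE BE lL //=; lia.
move: dL12; rewrite det_trig //; have iN : (i < n)%N by have := ltn_ord j; lia.
move=> /prodf_neq0 /(_ (Ordinal iN) isT); rewrite !mxE BE.
set r := lshift _ _; set s := cast_ord _ _.
have -> : r = i by apply: val_inj.
by have -> : s = j by apply: val_inj; rewrite /= ij addnC.
Qed.

(** Below row k the term with T vanishes. Column b of R ends at the entry b + k, Q adds one more,
    and back substitution lowers the bound by k, to b + 1. *)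
Lemma format_hess m (Z : 'M[C]_(n + k, k)) (A : 'M[C]_(n + k)) :
  stored_rotations n k m -> proper_lower_hess k (stored_L n k m) ->
  A = stored_L n k m *m (stored_Q n k m + stored_T n k m *m Z^t*) *m stored_R n k m ->
  dsubmx A = 0 -> upper_hess 1 A.
Proof.
move=> rm [lL pL] AE A0; apply/supp_upper_hess => b.
apply: (backsubstitution lL (fun i j => pL i j)) => [a na|a /andP[ba an]].
  rewrite /ent; case: insubP => // i iN ia.
  have ia' : nat_of_ord i = a := ia.
  have kN : (i - n < k)%N by have := ltn_ord i; lia.
  have <- : rshift n (Ordinal kN) = i by apply: val_inj => /=; lia.
  by have := congr1 (fun M : 'M_(_, _) => M (Ordinal kN) b) A0; rewrite !mxE.
rewrite AE -!mulmxA [X in ent X](mulmxA _ (stored_L n k m)).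
rewrite unitary_adjl ?stored_L_unitary // mul1mx mulmxDl entD -mulmxA.
rewrite ent_TM ?leq_addr // addr0.
have := @stored_Q_supp m _ (stored_R n k m) b (b + k); apply; last by lia.
by move: b {ba}; apply/supp_upper_hess/stored_R_hess.
Qed.

End Format.

(** * The chase as matrix identities *)

Section Chase.
Variables (C : numClosedFieldType) (n k : nat).
Notation N := (n + k)%N.
Variables (mu : C) (A : 'M[C]_(n + k)) (T : 'M[C]_(n + k, k)).

Definition shifted_column : 'cV[C]_(n + k) := (A - mu%:M) *m e1 C (n + k).

(* [L] is the product of the stored factor and of the pending rotation; [P] is the
   product of the rotations applied so far.  The last condition makes the first
   column of the final P a multiple of the shifted column. *)
Definition chased (L Q R : 'M[C]_(n + k)) (Z : 'M[C]_(n + k, k)) : Prop :=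
  exists P1 : 'M[C]_n, let P : 'M[C]_(n + k) := block_mx P1 0 0 1%:M in
  [/\ P \is unitarymx,
      L *m (Q + T *m Z^t*) *m R = P^t* *m A *m P,
      dsubmx (L *m T) = - 1%:M,
      Z^t* = dsubmx L *m Q
    & supp k (ent (L^t* *m P^t* *m shifted_column) ord0)].

Lemma dsub_gv i g q (M : 'M[C]_(n + k, q)) :
  (0 < i < n)%N -> dsubmx (gv N i g *m M) = dsubmx M.
Proof.
move=> iN; rewrite gv_block // -[M in LHS]vsubmxK mul_block_col col_mxKd.
by rewrite mul0mx mul1mx add0r.
Qed.

(** One sweep. [g] is the similarity, [B] the same rotation after its way through R, and [Y] the new
    pending rotation, or 1 in the last sweep. As Y fixes T, (Q + T Z^H) B = Y (Q' + T Z'^H). The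
    tested vector is only multiplied by the adjoint of Y, because the factor [g] taken from L
    cancels against the one put into P. *)
Lemma chased_step L L' Y Q Q' R R' Z Z' i g B :
  (0 < i < n)%N -> rotation g -> B \is unitarymx -> Y *m T = T ->
  (forall M : 'cV[C]_(n + k), supp k (ent M ord0) ->
     supp k (ent (Y^t* *m M) ord0)) ->
  L = gv N i g *m L' -> R *m gv N i g = B *m R' -> Q *m B = Y *m Q' ->
  Z' = B^t* *m Z ->
  chased L Q R Z -> chased (L' *m Y) Q' R' Z'.
Proof.
move=> iN rg uB YT sY LE RE QE -> [P1 [uP AE LT ZE sx]].
have uG : gv N i g \is unitarymx by apply: gv_unitary => //; lia.
exists (P1 *m gv n i g).
have PE : block_mx (P1 *m gv n i g) 0 0 1%:M = block_mx P1 0 0 1%:M *m gv N i g.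
  rewrite gv_block // mulmx_block.
  by rewrite !(mulmx0, mul0mx, mulmx1, addr0, add0r).
move: uP AE sx; rewrite PE; move: (block_mx P1 0 0 1%:M) => P uP AE sx.
have L'E : L' = (gv N i g)^t* *m L.
  by rewrite LE mulmxA unitary_adjl // mul1mx.
have BZ : (B^t* *m Z)^t* = Z^t* *m B by rewrite trmxC_mul trmxC_inv.
split.
- exact: mul_unitarymx.
- have F : Y *m (Q' + T *m (Z^t* *m B)) = (Q + T *m Z^t*) *m B.
    by rewrite mulmxDr -QE mulmxA YT mulmxDl mulmxA.
  rewrite BZ -(mulmxA L') F.
  transitivity ((gv N i g)^t* *m (L *m (Q + T *m Z^t*) *m R) *m gv N i g).
    by rewrite L'E -!mulmxA RE.
  by rewrite AE trmxC_mul !mulmxA.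
- by rewrite -mulmxA YT -LT LE -mulmxA dsub_gv.
- by rewrite BZ ZE LE !mul_dsub_mx -!mulmxA -QE dsub_gv.
- rewrite !trmxC_mul -!mulmxA; apply: sY.
  by move: sx; rewrite LE !trmxC_mul -!mulmxA.
Qed.

End Chase.

Section QRStep.
Variables (C : numClosedFieldType) (n k : nat).
Notation N := (n + k)%N.

(* The shifted column x satisfies L^* x = F R e_1 - mu L^* e_1; only its entries
   k + 1 and k + 2 survive below the leading k rows, and the adjoint of the
   rotation [g] annihilates the second one. *)
Lemma chased_init (mu : C) (A : 'M[C]_(n + k)) (m : memory C) g Q' :
  (1 < n)%N -> (0 < k)%N -> factored_format m A -> rotation g ->
  let r := \prod_(1 <= j < k.+1) m 4 j j in
  let l := \prod_(1 <= j < k.+1) - m 2 j j in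
  let z1 := m 5 0 k.+1 * m 7 0 k.+1 * r - mu * l in
  let z2 := m 6 0 k.+1 * m 7 0 k.+1 * r in
  g.1 * z2 = g.2 * z1 ->
  gv N k.+1 g *m Q' = stored_Q n k m ->
  chased mu A (stored_T n k m) (stored_L n k m *m gv N k.+1 g) Q'
    (stored_R n k m) (stored_Z n k m).
Proof.
move=> n1 k0 [[rm A0] _ _ [_ [_ _ LT ZE]] AE] rg r l z1 z2 gz QE.
have kN : (0 < k.+1 < N)%N by lia.
have uX := gv_unitary kN rg.
have XT : gv N k.+1 g *m stored_T n k m = stored_T n k m.
  apply: entP => j a; rewrite ent_gv // -[stored_T n k m]mulmx1.
  case: eqP => [ak|ak]; first by rewrite !ent_TM /rot1 ?mulr0 ?subr0 //; lia.
  case: eqP => [ak'|//]; rewrite !ent_TM /rot2 ?mulr0 ?addr0 //; lia.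
exists 1%:M; rewrite -scalar_mx_block; split.
- by apply/unitarymxP; rewrite mul1mx trmxC1.
- rewrite trmxC1 mul1mx mulmx1 [RHS]AE -(mulmxA (stored_L n k m)) mulmxDr QE.
  by rewrite mulmxA XT.
- by rewrite -mulmxA XT.
- by rewrite ZE -!mul_dsub_mx -mulmxA QE.
rewrite trmxC1 mulmx1 trmxC_mul gv_adj -mulmxA.
set w := (stored_L n k m)^t* *m _.
have wE : w = (stored_Q n k m + stored_T n k m *m (stored_Z n k m)^t*)
    *m stored_R n k m *m e1 C N - mu *: ((stored_L n k m)^t* *m e1 C N).
  rewrite /w /shifted_column mulmxBl mulmxBr mul_scalar_mx -scalemxAr.
  rewrite [in LHS]AE -!mulmxA [X in X - _]mulmxA unitary_adjl ?mul1mx //.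
  exact: stored_L_unitary.
have N0 : (0 < N)%N by lia.
have se : supp 0 (ent (e1 C N) ord0).
  by move=> a a0; rewrite ent_e1 //; case: eqP => //; lia.
have e0 : ent (e1 C N) ord0 0%N = 1 by rewrite ent_e1.
have Lk : ent ((stored_L n k m)^t* *m e1 C N) ord0 k = l.
  by rewrite stored_L_adj Hprod_entry ?e0 ?mulr1 // => i ik; lia.
have Ls : supp k (ent ((stored_L n k m)^t* *m e1 C N) ord0).
  rewrite stored_L_adj -{1}[k]add0n; apply: Hprod_supp => // i ik; lia.
have Rk : ent (stored_R n k m *m e1 C N) ord0 k = r.
  by rewrite stored_RE Hprod_entry ?e0 ?mulr1 // => i ik; lia.
have Rs : supp k (ent (stored_R n k m *m e1 C N) ord0).
  by rewrite stored_RE -{1}[k]add0n; apply: Hprod_supp.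
have wa a : (k <= a)%N -> ent w ord0 a =
   ent (stored_Q n k m *m (stored_R n k m *m e1 C N)) ord0 a
     - mu * ent ((stored_L n k m)^t* *m e1 C N) ord0 a.
  move=> ka; rewrite wE entB entZ -mulmxA mulmxDl entD -[X in _ + ent X _ _]mulmxA.
  by rewrite ent_TM // addr0.
move: wa; rewrite stored_QE -mulmxA.
set v := diag_mx _ *m _ => wa.
have sv : supp k (ent v ord0).
  by move=> a ka; rewrite /v (@ent_diag _ _ _ (m 7 0%N)) Rs ?mulr0.
have vk : ent v ord0 k = m 7 0 k.+1 * r.
  by rewrite /v (@ent_diag _ _ _ (m 7 0%N)) Rk.
have [|v1 v2 v3] := rowprod_asc_entries (m 5 0%N) (m 6 0%N) _ (leqnn N) sv.
  by lia.
(* The 0-based entries k and k + 1 of [w] are [z1] and [z2]. The adjoint rotation turns the second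
   one into [g.1 * z2 - g.2 * z1], which is zero by hypothesis. *)
move=> a ka; rewrite ent_gv //.
case: eqP => [?|_]; first lia.
case: eqP => [ak|ak].
  rewrite ak /= /rot2 !wa //= v1 v2 vk Lk (Ls k.+1) // /adj /=; conj_simpl.
  rewrite mulr0 subr0 !mulrA -/z1 -/z2 mulNr -gz addrC /z2; ring.
by rewrite wa ?v3 ?Ls ?mulr0 ?subr0 //; lia.
Qed.

Lemma chased_qr_step (mu : C) (A : 'M[C]_(n + k)) (m : memory C) :
  (0 < n)%N -> dsubmx A = 0 -> stored_rotations n k m ->
  chased mu A (stored_T n k m) (stored_L n k m) (stored_Q n k m)
    (stored_R n k m) (stored_Z n k m) ->
  upper_hess 0 (stored_Tk k m) -> stored_Tk k m \in unitmx ->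
  let A1 := stored_L n k m *m
    (stored_Q n k m + stored_T n k m *m (stored_Z n k m)^t*) *m stored_R n k m in
  qr_step mu A A1 /\ factored_format m A1.
Proof.
move=> n0 A0 rm [P1 [uP AE LT ZE sx]] hT uT A1.
have uL := stored_L_unitary rm.
have pL := proper_of_dsub uL (@stored_L_hess _ n k m) LT.
(* The two preserved identities make the last k rows of L (Q + T Z^H) equal to Z^H - Z^H. *)
have d0 : dsubmx A1 = 0.
  rewrite /A1 -!mul_dsub_mx mulmxDr -ZE mulmxA mul_dsub_mx LT mulNmx mul1mx.
  by rewrite subrr mul0mx.
have hA1 : upper_hess 1 A1 by apply: (format_hess rm pL _ d0).
split; last first.
  split=> //; first by split; [exact: stored_R_unitary | exact: stored_R_hess].
  by split; first exact: stored_Q_structure.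
exists P1; split=> //.
set P := block_mx _ _ _ _ in uP AE sx *; rewrite -/(shifted_column mu A).
set x := shifted_column mu A in sx * => x0.
(* P leaves the last k coordinates alone, and there x vanishes; L^H P^H x ends at the entry k. Back
   substitution with d = 0 leaves only the first entry. *)
have y0 : supp 0 (ent (P^t* *m x) ord0).
  case: pL => lL pL; apply: (backsubstitution lL pL) => a an.
    rewrite /ent; case: insubP => // i _ ia.
    have ia' : nat_of_ord i = a := ia.
    have kN : (i - n < k)%N by have := ltn_ord i; lia.
    have <- : rshift n (Ordinal kN) = i by apply: val_inj => /=; lia.
    have : dsubmx (P^t* *m x) = 0.
      rewrite /P tr_block_mx map_block_mx -[x]vsubmxK mul_block_col col_mxKd.
      rewrite trmx0 trmx1 map_mx0 map_mx1 mul0mx mul1mx add0r.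
      rewrite /x /shifted_column mulmxBl linearB /= -mul_dsub_mx A0 mul0mx sub0r.
      apply/matrixP => p q; rewrite mul_scalar_mx !mxE /= addn_eq0.
      by case: eqP => //= ?; [lia | rewrite mulr0 oppr0].
    by move=> /(congr1 (fun M : 'M_(_, _) => M (Ordinal kN) ord0)); rewrite !mxE.
  by rewrite mulmxA sx //; lia.
have N0 : (0 < N)%N by lia.
pose b := ent (P^t* *m x) ord0 0%N.
have yE : P^t* *m x = b *: e1 C N.
  apply: entP => j a; rewrite (ord1 j) entZ ent_e1 //.
  by case: eqP => [->|a0]; rewrite ?mulr1 ?mulr0 // y0 //; lia.
have xE : x = b *: (P *m e1 C N).
  by rewrite scalemxAr -yE mulmxA (unitary_adjr uP) mul1mx.
have b0 : b != 0 by apply: contraNneq x0 => b0; rewrite xE b0 scale0r.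
by exists b^-1; rewrite xE scalerA mulVf // scale1r.
Qed.

(* (A11 - mu)^-1 P1 intertwines two Hessenberg matrices and maps e_1 to a
   multiple of e_1, so it is upper triangular. *)
Lemma qr_step_proper (mu : C) (A A1 : 'M[C]_(n + k)) :
  (0 < n)%N -> dsubmx A = 0 -> proper_upper_hess 1 (ulsubmx A) ->
  qr_step mu A A1 -> ~~ eigenvalue (ulsubmx A) mu ->
  proper_upper_hess 1 (ulsubmx A1).
Proof.
move=> n0 A0 [hA pA] [P1 [uP Pe A1E hA1]] nev.
set B := ulsubmx A in hA pA nev; set B1 := ulsubmx A1.
have hB1 : upper_hess 1 B1 by move=> i j ij; rewrite !mxE hA1.
have Ablk : A = block_mx B (ursubmx A) 0 0.
  by rewrite -[LHS]submxK /dlsubmx /drsubmx A0 !linear0.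
have uP1 : P1 \is unitarymx.
  move/unitarymxP: uP; rewrite tr_block_mx map_block_mx mulmx_block scalar_mx_block.
  case/eq_block_mx; rewrite trmx0 map_mx0 mulmx0 addr0 => ? _ _ _.
  exact/unitarymxP.
have B1E : B1 = P1^t* *m B *m P1.
  rewrite /B1 A1E Ablk tr_block_mx map_block_mx !mulmx_block block_mxKul.
  by rewrite !(trmx0, map_mx0, mul0mx, mulmx0, addr0).
have uB : B - mu%:M \in unitmx.
  rewrite unitmxE unitfE; apply: contra nev => /det0P[v v0 vB].
  apply/eigenvalueP; exists v => //; apply/eqP.
  by rewrite -subr_eq0 -mul_mx_scalar -mulmxBr vB.
pose M := invmx (B - mu%:M) *m P1.
have MB : B *m M = M *m B1.
  have cB : B *m invmx (B - mu%:M) = invmx (B - mu%:M) *m B.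
    rewrite -[RHS]mulmx1 -(mulmxV uB) mulmxA; congr (_ *m _).
    rewrite -mulmxA; apply/(canRL (mulKmx uB)).
    by rewrite mulmxBl mulmxBr mul_scalar_mx mul_mx_scalar.
  rewrite /M B1E mulmxA cB -!mulmxA [P1 *m _]mulmxA (unitary_adjr uP1).
  by rewrite mul1mx.
have uM : M \in unitmx by rewrite unitmx_mul unitmx_inv uB unitarymx_unit.
have e1E : e1 C N = col_mx (e1 C n) 0.
  apply/matrixP => i j; rewrite -(splitK i); case: (split i) => i' /=.
    by rewrite col_mxEu !mxE.
  by rewrite col_mxEd !mxE /= addn_eq0; case: eqP => //; lia.
have xE : (A - mu%:M) *m e1 C N = col_mx ((B - mu%:M) *m e1 C n) 0.
  rewrite e1E Ablk scalar_mx_block opp_block_mx add_block_mx mul_block_col.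
  by rewrite !(mulmx0, addr0, oppr0, mul0mx).
have e10 : e1 C n != 0.
  by apply/eqP => /matrixP/(_ (Ordinal n0) ord0)/eqP; rewrite !mxE oner_eq0.
have x0 : (A - mu%:M) *m e1 C N != 0.
  rewrite xE; apply: contraNneq e10; rewrite -col_mx0 => /eq_col_mx[Be _].
  by rewrite -[e1 C n](mulKmx uB) Be mulmx0.
have [alpha] := Pe x0; rewrite xE e1E mul_block_col scale_col_mx => /eq_col_mx[].
rewrite mulmx0 addr0 => P1e _.
have Me : M *m e1 C n = alpha *: e1 C n.
  by rewrite /M -mulmxA P1e -scalemxAr mulKmx.
clearbody M B B1; have Me0 i : M i (Ordinal n0) = alpha * (i == 0%N :> nat)%:R.
  have := congr1 (fun v : 'cV_n => v i ord0) Me; rewrite !mxE => <-.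
  rewrite (bigD1 (Ordinal n0)) //= big1 => [|l]; first by rewrite mxE mulr1 addr0.
  by rewrite -val_eqE /= mxE => /negPf ->; rewrite mulr0.
have alpha0 : alpha != 0.
  apply: contraNneq e10 => al0.
  by rewrite -[e1 C n](mulKmx uM) Me al0 scale0r mulmx0.
(* The entry (i, o) of B M = M B1: triangularity of the columns of M up to o and the Hessenberg
   shape of both matrices leave one term on each side. *)
have key (o o1 i : 'I_n) : o1 = o.+1 :> nat ->
    (forall l : 'I_n, (l <= o)%N -> forall i : 'I_n, (l < i)%N -> M i l = 0) ->
    (o < i)%N -> B i o * M o o = M i o1 * B1 o1 o.
  move=> o1E IH oi; have := congr1 (fun v : 'M_n => v i o) MB; rewrite !mxE.
  rewrite (bigD1 o) //= big1 => [|l lo]; last first.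
    have [ol|lo'] := ltnP o l; first by rewrite (IH o) ?mulr0.
    by rewrite hA ?mul0r //; move: lo; rewrite -val_eqE /=; lia.
  rewrite (bigD1 o1) //= big1 ?addr0 // => l lo.
  have [ol|lo'] := leqP l o; first by rewrite (IH l) ?mul0r //; lia.
  by rewrite hB1 ?mulr0 //; move: lo; rewrite -val_eqE /=; lia.
(* Induction on the columns. For i = l the left side of [K] is nonzero because B is proper, so
   [M l l] and the subdiagonal entry of [B1] are nonzero; for i > l it is zero, so [M i l]
   vanishes. *)
have tri j : forall l : 'I_n, (l <= j)%N ->
    (forall i : 'I_n, (l < i)%N -> M i l = 0) /\ M l l != 0.
  elim: j => [|j IH] l lj.
    have -> : l = Ordinal n0 by apply: val_inj => /=; lia.
    split=> [i i0|]; last by rewrite Me0 eqxx mulr1.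
    by rewrite Me0; case: eqP i0 => [->|_] //; rewrite mulr0.
  have [lj'|jl] := leqP l j; first exact: IH.
  have lE : l = j.+1 :> nat by lia.
  have jn : (j < n)%N by have := ltn_ord l; lia.
  have K i := @key (Ordinal jn) l i lE (fun l' H => (IH l' H).1).
  have [_ Mj] := IH (Ordinal jn) (leqnn j).
  have Bl : B l (Ordinal jn) != 0 by apply: pA; rewrite /= addn1.
  have Kl : B l (Ordinal jn) * M (Ordinal jn) (Ordinal jn) = M l l * B1 l (Ordinal jn).
    by apply: K; rewrite /= lE.
  have : M l l * B1 l (Ordinal jn) != 0 by rewrite -Kl mulf_neq0.
  rewrite mulf_eq0 negb_or => /andP[Ml B1l]; split=> // i li.
  have := K i; rewrite (hA i) /= ?addn1 -?lE // mul0r => /(_ (ltnW _)).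
  move=> /(_ ltac:(lia)) /eqP.
  by rewrite eq_sym mulf_eq0 (negPf B1l) orbF => /eqP.
split=> // i j ij.
have K := @key j i i _ (fun l H => (tri j l H).1).
have [_ Mj] := tri j j (leqnn j).
have : M i i * B1 i j != 0.
  by rewrite -K ?mulf_neq0 ?pA //; lia.
by rewrite mulf_eq0 negb_or => /andP[].
Qed.

End QRStep.

(** * Programs *)

Section ProgramLogic.
Variable C : numClosedFieldType.
Implicit Types (s : nat -> nat) (m : memory C) (t : nat).

(** Total correctness: a run-time error falsifies every triple, so the bounds on the operation count
    are never vacuous. *)
Definition runs (c : cmd) s m t (Q : (nat -> nat) -> memory C -> nat -> Prop) :=
  exists s' m' t', exec c (s, m, t) = Some (s', m', t') /\ Q s' m' t'.

Lemma runs_conseq c s m t (P Q : (nat -> nat) -> memory C -> nat -> Prop) :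
  (forall s' m' t', P s' m' t' -> Q s' m' t') -> runs c s m t P -> runs c s m t Q.
Proof. by move=> PQ [s' [m' [t' [e /PQ q]]]]; exists s', m', t'. Qed.

Lemma runs_skip s m t (Q : (nat -> nat) -> memory C -> nat -> Prop) :
  Q s m t -> runs Skip s m t Q.
Proof. by exists s, m, t. Qed.

Lemma runs_seq c1 c2 s m t (Q : (nat -> nat) -> memory C -> nat -> Prop) :
  runs c1 s m t (fun s' m' t' => runs c2 s' m' t' Q) -> runs (Seq c1 c2) s m t Q.
Proof.
move=> [s1 [m1 [t1 [e1 [s2 [m2 [t2 [e2 q]]]]]]]]; exists s2, m2, t2; split=> //.
by rewrite /= e1 /= e2.
Qed.

(* The new value is generalized, so that terms do not grow along a program. *)
Lemma runs_cset a i j e x s m t (Q : (nat -> nat) -> memory C -> nat -> Prop) :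
  ceval s m e = Some x ->
  (forall y, y = x ->
     Q s (upd_mem m a (neval s i) (neval s j) y) (t + arith_ops e)%N) ->
  runs (CSet a i j e) s m t Q.
Proof.
move=> ex /(_ x erefl) q.
exists s, (upd_mem m a (neval s i) (neval s j) x), (t + arith_ops e)%N.
by rewrite /= ex.
Qed.

Lemma runs_ifleq e1 e2 c1 c2 s m t (Q : (nat -> nat) -> memory C -> nat -> Prop) :
  ((neval s e1 <= neval s e2)%N -> runs c1 s m t Q) ->
  ((neval s e2 < neval s e1)%N -> runs c2 s m t Q) ->
  runs (IfLeq e1 e2 c1 c2) s m t Q.
Proof. by rewrite /runs /=; case: leqP => _ H1 H2; [apply: H1 | apply: H2]. Qed.

Lemma runs_ifzero e x c1 c2 s m t (Q : (nat -> nat) -> memory C -> nat -> Prop) :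
  ceval s m e = Some x ->
  (x = 0 -> runs c1 s m (t + arith_ops e).+1 Q) ->
  (x != 0 -> runs c2 s m (t + arith_ops e).+1 Q) ->
  runs (IfZero e c1 c2) s m t Q.
Proof.
by rewrite /runs /= => -> /=; case: eqP => ? H1 H2; [apply: H1 | apply: H2].
Qed.

Lemma runs_for v e body (I : nat -> (nat -> nat) -> memory C -> nat -> Prop) s m t :
  I 0%N s m t ->
  (forall x s' m' t', (x < neval s e)%N -> I x s' m' t' ->
     runs body (upd_var s' v x) m' t' (I x.+1)) ->
  runs (For v e body) s m t (I (neval s e)).
Proof.
rewrite /runs /=; move: (neval s e) => l I0 step.
have {step} : forall x s' m' t', (0 <= x < 0 + l)%N -> I x s' m' t' ->
    runs body (upd_var s' v x) m' t' (I x.+1) by move=> x s' m' t' xl; apply: step.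
rewrite -{3}[l]add0n; move: 0%N s m t I0.
elim: l => [|l IH] z s m t Iz step; first by exists s, m, t; rewrite addn0.
have [|s1 [m1 [t1 [e1 I1]]]] := step z s m t _ Iz; first by lia.
rewrite /= e1 -addSnnS; apply: (IH z.+1 s1 m1 t1 I1) => x s' m' t' xl.
by apply: step; lia.
Qed.

End ProgramLogic.

(** * Normalization and turnover as programs *)

Definition seqs : seq cmd -> cmd := foldr Seq Skip.
(* Array 10 is the scratch memory; cells (0, 0) and (0, 1) hold the cosine and the
   sine of the pending rotation. *)
Definition scr (x : nat) : cexpr := CLoc 10 (NLit 0) (NLit x).
Definition set_scr (x : nat) : cexpr -> cmd := CSet 10 (NLit 0) (NLit x).

Definition csq (e : cexpr) : cexpr := CMul e (CConj e).

(* Writes cells 9 and 10 as (c r, s r), with the rotation (c, s) in cells 15 and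
   16, and the real number r in cell 18. *)
Definition normalize : cmd := seqs [::
  set_scr 14 (CAdd (csq (scr 9)) (csq (scr 10)));
  IfZero (scr 14)
    (seqs [:: set_scr 15 (CLit 1); set_scr 16 (CLit 0); set_scr 18 (CLit 0)])
    (seqs [:: set_scr 18 (CSqrt (scr 14)); set_scr 15 (CDiv (scr 9) (scr 18));
              set_scr 16 (CDiv (scr 10) (scr 18))])].

(* In: rotations a, b, c in scratch cells 2-7.  Out: a', b', c' in cells 15-20,
   with G_1(a) G_2(b) G_1(c) = G_2(a') G_1(b') G_2(c').  Cells 8-10 and 11-13 are
   the first two columns of the left-hand side. *)
Definition turnover : cmd := seqs [::
  set_scr 8 (CSub (CMul (scr 2) (scr 6))
               (CMul (CConj (scr 3)) (CMul (scr 4) (scr 7))));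
  set_scr 9 (CAdd (CMul (scr 3) (scr 6))
               (CMul (CConj (scr 2)) (CMul (scr 4) (scr 7))));
  set_scr 10 (CMul (scr 5) (scr 7));
  set_scr 11 (CSub (CMul (scr 2) (CSub (CLit 0) (CConj (scr 7))))
               (CMul (CConj (scr 3)) (CMul (scr 4) (CConj (scr 6)))));
  set_scr 12 (CAdd (CMul (scr 3) (CSub (CLit 0) (CConj (scr 7))))
               (CMul (CConj (scr 2)) (CMul (scr 4) (CConj (scr 6)))));
  set_scr 13 (CMul (scr 5) (CConj (scr 6)));
  normalize;
  set_scr 17 (scr 8);
  set_scr 19 (CAdd (CMul (CSub (CLit 0) (scr 18)) (scr 11))
    (CMul (scr 17) (CAdd (CMul (CConj (scr 15)) (scr 12))
                         (CMul (CConj (scr 16)) (scr 13)))));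
  set_scr 20 (CSub (CMul (scr 15) (scr 13)) (CMul (scr 16) (scr 12)))].

Ltac assign x e :=
  apply: runs_seq; apply: runs_cset; [by rewrite /upd_mem /= | move=> x e /=].

Section Turnover.
Variable C : numClosedFieldType.
Implicit Types (s : nat -> nat) (m : memory C) (t : nat).

Definition rot_at m ac as_ j i : C * C := (m ac j i, m as_ j i).
Definition scr_rot m x : C * C := (m 10 0%N x, m 10 0%N x.+1).

Lemma unit_vector (x y r : C) : 0 <= x * x^* + y * y^* -> 
  x * x^* + y * y^* != 0 -> r = sqrtC (x * x^* + y * y^*) ->
  [/\ r != 0, r^* = r & rotation (x / r, y / r)].
Proof.
move=> n0 nz ->; have r0 : sqrtC (x * x^* + y * y^*) != 0 by rewrite sqrtC_eq0.
have rr : (sqrtC (x * x^* + y * y^*))^* = sqrtC (x * x^* + y * y^*).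
  by apply: conj_Creal; rewrite ger0_real // sqrtC_ge0.
move: (sqrtCK (x * x^* + y * y^*)) r0 rr; move: (sqrtC _) => {}r rE r0 rr.
split=> //; rewrite /rotation is_rotationE /= !fmorph_div /= rr !mulf_div -mulrDl.
by rewrite -rE expr2 divff // mulf_neq0.
Qed.

(** The zero test guards the division. A sum of two squared moduli is a nonnegative real, so the
    square root is defined, and it vanishes only if both numbers do; then the rotation (1, 0) and r
    = 0 are returned. *)
Lemma runs_normalize s m t (Q : (nat -> nat) -> memory C -> nat -> Prop) :
  (forall m' t', (t' <= t + 20)%N ->
     (forall a i j, (a != 10%N) || (j < 14)%N -> m' a i j = m a i j) ->
     rotation (scr_rot m' 15) -> (m' 10 0 18)^* = m' 10 0 18 ->
     m 10 0 9 = m' 10 0 15 * m' 10 0 18 -> m 10 0 10 = m' 10 0 16 * m' 10 0 18 ->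
     Q s m' t') ->
  runs normalize s m t Q.
Proof.
move=> H; rewrite /normalize /seqs /=; assign x14 e14.
have frame a i j l y (m1 : memory C) : (13 < l)%N -> (a != 10%N) || (j < 14)%N ->
    upd_mem m1 10 0 l y a i j = m1 a i j.
  by move=> l13 aj; rewrite /upd_mem; case: and3P => // -[/eqP ? _ /eqP ?]; lia.
have n14 : 0 <= x14 by rewrite e14 addr_ge0 ?mul_conjC_ge0.
apply: runs_seq; apply: runs_ifzero; first by rewrite /upd_mem /=.
  move=> x140; assign x15 e15; assign x16 e16; assign x18 e18.
  do 2!apply: runs_skip; apply: H; rewrite /scr_rot; first by rewrite /=; lia.
  - by move=> a i j aj; rewrite !frame.
  - rewrite /upd_mem /= e15 e16 /rotation /is_rotation /= normr1 normr0.
    by rewrite expr1n expr0n addr0.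
  - by rewrite /upd_mem /= e18 rmorph0.
  - have : x14 == 0 by rewrite x140.
    rewrite e14 paddr_eq0 ?mul_conjC_ge0 // !mul_conjC_eq0 => /andP[/eqP-> _].
    by rewrite /upd_mem /= e18 mulr0.
  - have : x14 == 0 by rewrite x140.
    rewrite e14 paddr_eq0 ?mul_conjC_ge0 // !mul_conjC_eq0 => /andP[_ /eqP->].
    by rewrite /upd_mem /= e18 mulr0.
move=> x140; apply: runs_seq; apply: runs_cset.
  by rewrite /upd_mem /= n14.
move=> x18 e18 /=; rewrite e14 in n14 x140 e18.
have [r0 rr rg] := unit_vector n14 x140 e18.
apply: runs_seq; apply: runs_cset.
  by rewrite /upd_mem /= (negPf r0).
move=> x15 e15 /=; apply: runs_seq; apply: runs_cset.
  by rewrite /upd_mem /= (negPf r0).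
move=> x16 e16 /=; do 2!apply: runs_skip; apply: H; rewrite /scr_rot.
- by rewrite /=; lia.
- by move=> a i j aj; rewrite !frame.
- by rewrite /upd_mem /= e15 e16.
- by rewrite /upd_mem /=.
- by rewrite /upd_mem /= e15 divfK.
- by rewrite /upd_mem /= e16 divfK.
Qed.

Lemma runs_turnover s m t (Q : (nat -> nat) -> memory C -> nat -> Prop) :
  rotation (scr_rot m 2) -> rotation (scr_rot m 4) -> rotation (scr_rot m 6) ->
  (forall m' t', (t' <= t + 100)%N ->
     (forall a i j, a != 10%N -> m' a i j = m a i j) ->
     rotation (scr_rot m' 15) -> rotation (scr_rot m' 17) ->
     rotation (scr_rot m' 19) ->
     (forall x,
       act12 (scr_rot m 2) (act23 (scr_rot m 4) (act12 (scr_rot m 6) x)) =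
       act23 (scr_rot m' 15) (act12 (scr_rot m' 17) (act23 (scr_rot m' 19) x))) ->
     Q s m' t') ->
  runs turnover s m t Q.
Proof.
move=> ra rb rc H; rewrite /turnover /seqs [foldr _ _ _]/=.
assign x8 e8; assign x9 e9; assign x10 e10.
assign x11 e11; assign x12 e12; assign x13 e13.
apply: runs_seq; apply: runs_normalize => m1 t1 t1t fr rg rr x9E x10E.
rewrite /upd_mem /= in x9E x10E.
assign x17 e17; assign x19 e19; assign x20 e20; apply: runs_skip.
(* The number r left in cell 18 is also the sine of the middle rotation, whose cosine goes to cell
   17. *)
have [|| rb' rc' eq] := turnover_exists ra rb rc rg rr.
- by rewrite -[RHS]x9E e9 /= /rot1 /rot2 /=; ring.
- by rewrite -[RHS]x10E e10 /= /rot1 /rot2 /=; ring.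
have x17E : x17 = (act12 (scr_rot m 2) (act23 (scr_rot m 4)
                     (act12 (scr_rot m 6) (E1 C)))).1.1.
  rewrite e17 fr // /upd_mem /= e8 /= /rot1 /rot2 /=; ring.
have x11E : x11 = (act12 (scr_rot m 2) (act23 (scr_rot m 4)
                     (act12 (scr_rot m 6) (E2 C)))).1.1.
  by rewrite e11 /= /rot1 /rot2 /=; ring.
have x12E : x12 = (act12 (scr_rot m 2) (act23 (scr_rot m 4)
                     (act12 (scr_rot m 6) (E2 C)))).1.2.
  by rewrite e12 /= /rot1 /rot2 /=; ring.
have x13E : x13 = (act12 (scr_rot m 2) (act23 (scr_rot m 4)
                     (act12 (scr_rot m 6) (E2 C)))).2.
  by rewrite e13 /= /rot1 /rot2 /=; ring.
rewrite -x17E in rb' rc' eq.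
move: rc' eq x11E x12E x13E; move: (act12 _ (act23 _ (act12 _ (E2 C)))).
move=> v rc' eq x11E x12E x13E; move: rc' eq.
set g3 := (X in rotation X); have gE : g3 = (x19, x20).
  rewrite /g3 /=; congr (_, _).
    rewrite e19 /= /rot1 /rot2 /= -x11E -x12E -x13E.
    rewrite (fr 10 0 11)%N // (fr 10 0 12)%N // (fr 10 0 13)%N // /upd_mem /=.
    by conj_simpl; ring.
  rewrite e20 /= /rot1 /rot2 /= -x12E -x13E.
  rewrite (fr 10 0 12)%N // (fr 10 0 13)%N // /upd_mem /=.
  by conj_simpl; ring.
rewrite gE => rc' eq; apply: H.
- by rewrite /= in t1t *; lia.
- by move=> a i j a10; rewrite /upd_mem (negPf a10) /= fr ?a10 // /upd_mem (negPf a10).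
- by rewrite /scr_rot /upd_mem /=.
- exact: rb'.
- by rewrite /scr_rot /upd_mem /=.
- by move=> x; rewrite eq -[(_, (act12 _ _).2)]/g3 gE.
Qed.

End Turnover.

(** * The pending rotation crosses one line of rotations *)

Definition swap_c (b : bool) (e : cexpr) : cexpr := if b then CConj e else e.
Definition swap_s (b : bool) (e : cexpr) : cexpr :=
  if b then CSub (CLit 0) (CConj e) else e.

(* Rewrites G_q1 G_q2 X_q1 as X_q2 G_q1 G_q2, where X is the pending rotation.  When
   [b] holds, q1 = q2 + 1 and [turnover] sees the three coordinates in reverse
   order, which turns (c, s) into its conjugate with the sign of s reversed. *)
Definition turn_at (b : bool) (ac as_ : nat) (j q1 q2 : nexpr) : cmd := seqs [::
  set_scr 2 (swap_c b (CLoc ac j q1)); set_scr 3 (swap_s b (CLoc as_ j q1));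
  set_scr 4 (swap_c b (CLoc ac j q2)); set_scr 5 (swap_s b (CLoc as_ j q2));
  set_scr 6 (swap_c b (scr 0)); set_scr 7 (swap_s b (scr 1));
  turnover;
  set_scr 0 (swap_c b (scr 15)); set_scr 1 (swap_s b (scr 16));
  CSet ac j q1 (swap_c b (scr 17)); CSet as_ j q1 (swap_s b (scr 18));
  CSet ac j q2 (swap_c b (scr 19)); CSet as_ j q2 (swap_s b (scr 20))].

Section Passes.
Variable C : numClosedFieldType.
Implicit Types (s : nat -> nat) (m : memory C) (t : nat).

Definition swap_if (b : bool) (g : C * C) := if b then swap g else g.

Lemma swap_if_rotation b g : rotation g -> rotation (swap_if b g).
Proof. by case: b => //; apply: swap_rotation. Qed.

Lemma swap_ifK b g : swap_if b (swap_if b g) = g.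
Proof. by case: b => //; apply: swapK. Qed.

Lemma ceval_swap_c b s m e x : ceval s m e = Some x ->
  ceval s m (swap_c b e) = Some (if b then x^* else x).
Proof. by case: b => //= ->. Qed.

Lemma ceval_swap_s b s m e x : ceval s m e = Some x ->
  ceval s m (swap_s b e) = Some (if b then - x^* else x).
Proof. by case: b => //= -> /=; rewrite sub0r. Qed.

Lemma swap_ifE b (x y : C) :
  (if b then x^* else x, if b then - y^* else y) = swap_if b (x, y).
Proof. by case: b. Qed.

(** All operands are copied to scratch cells before any result is written, so the update may be done
    in place. Array numbers below 10 keep the stored data apart from the scratch memory. *)
Lemma runs_turn_at b ac as_ j q1 q2 s m t
    (Q : (nat -> nat) -> memory C -> nat -> Prop) :
  (ac < 10)%N -> (as_ < 10)%N -> ac != as_ -> neval s q1 != neval s q2 ->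
  let jj := neval s j in let p1 := neval s q1 in let p2 := neval s q2 in
  rotation (rot_at m ac as_ jj p1) -> rotation (rot_at m ac as_ jj p2) ->
  rotation (scr_rot m 0) ->
  (forall m' t', (t' <= t + 150)%N ->
     (forall a i l, (a < 10)%N ->
        ~~ [&& (a == ac) || (a == as_), i == jj & (l == p1) || (l == p2)] ->
        m' a i l = m a i l) ->
     rotation (rot_at m' ac as_ jj p1) -> rotation (rot_at m' ac as_ jj p2) ->
     rotation (scr_rot m' 0) ->
     (forall x,
       act12 (swap_if b (rot_at m ac as_ jj p1))
        (act23 (swap_if b (rot_at m ac as_ jj p2))
          (act12 (swap_if b (scr_rot m 0)) x)) =
       act23 (swap_if b (scr_rot m' 0))
        (act12 (swap_if b (rot_at m' ac as_ jj p1))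
          (act23 (swap_if b (rot_at m' ac as_ jj p2)) x))) ->
     Q s m' t') ->
  runs (turn_at b ac as_ j q1 q2) s m t Q.
Proof.
move=> ac10 as10 acas q12 jj p1 p2 r1 r2 r0 H.
have frame a i l z (y : C) (m1 : memory C) : (a < 10)%N ->
    upd_mem m1 10 0 z y a i l = m1 a i l.
  by move=> a10; rewrite /upd_mem; case: eqP => // ?; lia.
rewrite /turn_at /seqs [foldr _ _ _]/= -/jj -/p1 -/p2.
apply: runs_seq; apply: runs_cset; first exact: ceval_swap_c.
move=> x2 e2; apply: runs_seq; apply: runs_cset; first exact: ceval_swap_s.
move=> x3 e3; apply: runs_seq; apply: runs_cset; first exact: ceval_swap_c.
move=> x4 e4; apply: runs_seq; apply: runs_cset; first exact: ceval_swap_s.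
move=> x5 e5; apply: runs_seq; apply: runs_cset; first exact: ceval_swap_c.
move=> x6 e6; apply: runs_seq; apply: runs_cset; first exact: ceval_swap_s.
move=> x7 e7; apply: runs_seq.
have a2 : (x2, x3) = swap_if b (rot_at m ac as_ jj p1).
  by rewrite e2 e3 swap_ifE /= !frame.
have a4 : (x4, x5) = swap_if b (rot_at m ac as_ jj p2).
  by rewrite e4 e5 swap_ifE /= !frame.
have a6 : (x6, x7) = swap_if b (scr_rot m 0).
  by rewrite e6 e7 swap_ifE /= /upd_mem /=.
apply: runs_turnover; rewrite /scr_rot /upd_mem /=.
- by rewrite a2; apply: swap_if_rotation.
- by rewrite a4; apply: swap_if_rotation.
- by rewrite a6; apply: swap_if_rotation.
rewrite a2 a4 a6 => m1 t1 t1t fr ra' rb' rc' E.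
apply: runs_seq; apply: runs_cset; first exact: ceval_swap_c.
move=> x0 e0; apply: runs_seq; apply: runs_cset; first exact: ceval_swap_s.
move=> x1 e1; apply: runs_seq; apply: runs_cset; first exact: ceval_swap_c.
move=> y1 f1; apply: runs_seq; apply: runs_cset; first exact: ceval_swap_s.
move=> z1 h1; apply: runs_seq; apply: runs_cset; first exact: ceval_swap_c.
move=> y2 f2; apply: runs_seq; apply: runs_cset; first exact: ceval_swap_s.
move=> z2 h2; apply: runs_skip; rewrite -/jj -/p1 -/p2.
have frame' a i l i' l' (y : C) (m2 : memory C) : (a < 10)%N ->
    upd_mem m2 a i l y 10%N i' l' = m2 10%N i' l'.
  by move=> a10; rewrite /upd_mem; case: eqP => // ?; lia.
have b0 : (x0, x1) = swap_if b (m1 10 0 15, m1 10 0 16).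
  by rewrite e0 e1 swap_ifE /= /upd_mem /=.
have b1 : (y1, z1) = swap_if b (m1 10 0 17, m1 10 0 18).
  by rewrite f1 h1 swap_ifE /=;
    rewrite ?(frame' as_) ?(frame' ac) ?(frame' as_) ?(frame' ac) // /upd_mem /=.
have b2 : (y2, z2) = swap_if b (m1 10 0 19, m1 10 0 20).
  by rewrite f2 h2 swap_ifE /=;
    rewrite ?(frame' as_) ?(frame' ac) ?(frame' as_) ?(frame' ac) // /upd_mem /=.
set m' := upd_mem _ _ _ _ _.
have m'0 : scr_rot m' 0 = (x0, x1).
  by rewrite /scr_rot /m';
    rewrite ?(frame' as_) ?(frame' ac) ?(frame' as_) ?(frame' ac) // /upd_mem /=.
have q12' : (p2 == p1) = false by rewrite eq_sym; apply: negbTE.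
have acas' : (as_ == ac) = false by rewrite eq_sym; apply: negbTE.
have m'1 : rot_at m' ac as_ jj p1 = (y1, z1).
  rewrite /rot_at /m' /upd_mem !eqxx !(negbTE acas) !acas' !(negbTE q12) /=.
  by [].
have m'2 : rot_at m' ac as_ jj p2 = (y2, z2).
  by rewrite /rot_at /m' /upd_mem !eqxx !(negbTE acas) !acas' /=.
apply: H; rewrite ?m'0 ?m'1 ?m'2 ?b0 ?b1 ?b2 ?swap_ifK //.
- by move: t1t; case: (b) => /=; lia.
- move=> a i l a10 nai; transitivity (m1 a i l); last first.
    have a10' : (a == 10%N) = false by apply/eqP; lia.
    by rewrite fr a10'.
  rewrite /m'; rewrite -[RHS](frame a i l 0 x0 m1 a10).
  rewrite -[RHS](frame a i l 1 x1 _ a10) /=.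
  move: nai; rewrite {1 2 3 4}/upd_mem.
  by case: (a == ac); case: (a == as_); case: (i == jj); case: (l == p1);
    case: (l == p2).
- exact: swap_if_rotation.
- exact: swap_if_rotation.
- exact: swap_if_rotation.
Qed.

Lemma turn_gv N b g1 g2 p x y1 y2 q1 q2 :
  (if b then q1 = q2.+1 else q2 = q1.+1) ->
  (0 < q1 < N)%N -> (0 < q2 < N)%N ->
  (forall v, act12 (swap_if b g1) (act23 (swap_if b g2) (act12 (swap_if b p) v)) =
     act23 (swap_if b x) (act12 (swap_if b y1) (act23 (swap_if b y2) v))) ->
  gv N q1 g1 *m gv N q2 g2 *m gv N q1 p =
  gv N q2 x *m gv N q1 y1 *m gv N q2 y2 :> 'M[C]_N.
Proof.
case: b => -> q1N q2N H; last by apply: gv_turnover => //; lia.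
have := @gv_turnover_swap _ N q2 g1 g2 p (swap x) (swap y1) (swap y2).
by rewrite !swapK; apply => //; lia.
Qed.

End Passes.

(** * The pending rotation crosses all lines of a factor *)

Section Sweeps.
Variable C : numClosedFieldType.
Implicit Types (s : nat -> nat) (m : memory C) (t : nat).

(** The common form of L and R: [J] lists the lines from left to right, and [lst j] the indices
    along line j. *)
Definition lines N (lst : nat -> seq nat) ac as_ m (J : seq nat) : 'M[C]_N :=
  \prod_(j <- J) rowprod N (lst j) (m ac j) (m as_ j).

Lemma lines_cat N lst ac as_ m J1 J2 :
  lines N lst ac as_ m (J1 ++ J2) =
  lines N lst ac as_ m J1 *m lines N lst ac as_ m J2.
Proof. exact: big_cat. Qed.

Lemma lines1 N lst ac as_ m j :
  lines N lst ac as_ m [:: j] = rowprod N (lst j) (m ac j) (m as_ j).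
Proof. exact: big_seq1. Qed.

Lemma eq_lines N lst ac as_ m m' J :
  (forall j i, j \in J -> m ac j i = m' ac j i /\ m as_ j i = m' as_ j i) ->
  lines N lst ac as_ m J = lines N lst ac as_ m' J.
Proof.
move=> H; apply: eq_big_seq => j jJ; apply: eq_rowprod => i _.
  exact: (H j i jJ).1.
exact: (H j i jJ).2.
Qed.

Lemma runs_turn_line N b ac as_ ej eq1 eq2 l l1 l2 s m t
    (Q : (nat -> nat) -> memory C -> nat -> Prop) :
  (ac < 10)%N -> (as_ < 10)%N -> ac != as_ ->
  let j := neval s ej in let q1 := neval s eq1 in let q2 := neval s eq2 in
  (if b then q1 = q2.+1 else q2 = q1.+1) ->
  (0 < q1 < N)%N -> (0 < q2 < N)%N -> l = l1 ++ q1 :: q2 :: l2 ->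
  {in l1, forall i, (0 < i < N)%N && ((i.+1 < q2)%N || (q2.+1 < i)%N)} ->
  {in l2, forall i, (0 < i < N)%N && ((i.+1 < q1)%N || (q1.+1 < i)%N)} ->
  {in l, forall i, rotation (rot_at m ac as_ j i)} -> rotation (scr_rot m 0) ->
  (forall m' t', (t' <= t + 150)%N ->
     (forall a j' i, (a < 10)%N -> ~~ [&& (a == ac) || (a == as_) & j' == j] ->
        m' a j' i = m a j' i) ->
     {in l, forall i, rotation (rot_at m' ac as_ j i)} -> rotation (scr_rot m' 0) ->
     rowprod N l (m ac j) (m as_ j) *m gv N q1 (scr_rot m 0) =
     gv N q2 (scr_rot m' 0) *m rowprod N l (m' ac j) (m' as_ j) ->
     Q s m' t') ->
  runs (turn_at b ac as_ ej eq1 eq2) s m t Q.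
Proof.
move=> ac10 as10 acas j q1 q2 qq q1N q2N -> H1 H2 rl r0 HQ.
have q12 : q1 != q2 by apply/eqP; case: (b) qq; lia.
have q1l : q1 \in l1 ++ [:: q1, q2 & l2] by rewrite mem_cat inE eqxx orbT.
have q2l : q2 \in l1 ++ [:: q1, q2 & l2] by rewrite mem_cat !inE eqxx !orbT.
apply: (runs_turn_at ac10 as10 acas q12 (rl _ q1l) (rl _ q2l) r0).
move=> m' t' t't fr r1 r2 r0' E; apply: HQ => //.
- move=> a j' i a10 aj; apply: fr => //.
  by apply: contra aj => /and3P[-> ->].
- move=> i il; have [->//|i1] := eqVneq i q1; have [->//|i2] := eqVneq i q2.
  have -> : rot_at m' ac as_ j i = rot_at m ac as_ j i; last exact: rl.
  by congr (_, _); rewrite fr // -/q1 -/q2 (negbTE i1) (negbTE i2) !andbF.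
have out i : i \in l1 ++ l2 -> (i != q1) && (i != q2).
  rewrite mem_cat => /orP[/H1|/H2]; by case: (b) qq; lia.
apply: rowprod_pass => //.
- move=> i /out /andP[i1 i2].
  by rewrite fr // -/q1 -/q2 (negbTE i1) (negbTE i2) !andbF.
- move=> i /out /andP[i1 i2].
  by rewrite fr // -/q1 -/q2 (negbTE i1) (negbTE i2) !andbF.
- exact: (turn_gv qq q1N q2N E).
Qed.

(* The pending rotation crosses the lines of [J] from the last to the first; its
   index is [idx v] after [v] lines. *)
Lemma runs_pass N b ac as_ ej eq1 eq2 (lst : nat -> seq nat) (J : seq nat)
    (idx : nat -> nat) s m t (Q : (nat -> nat) -> memory C -> nat -> Prop) :
  (ac < 10)%N -> (as_ < 10)%N -> ac != as_ -> size J = s 1%N -> uniq J ->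
  (forall v, (v < s 1)%N -> forall s', s' 0%N = s 0%N -> s' 1%N = s 1%N ->
     s' 2%N = s 2%N -> s' 3%N = v ->
     [/\ neval s' ej = nth 0%N J (s 1 - v.+1), neval s' eq1 = idx v
       & neval s' eq2 = idx v.+1]) ->
  (forall v, (v < s 1)%N -> if b then idx v = (idx v.+1).+1 else idx v.+1 = (idx v).+1) ->
  (forall v, (v <= s 1)%N -> (0 < idx v < N)%N) ->
  (forall v, (v < s 1)%N -> exists l1 l2,
     [/\ lst (nth 0%N J (s 1 - v.+1)) = l1 ++ idx v :: idx v.+1 :: l2,
         {in l1, forall i, (0 < i < N)%N && ((i.+1 < idx v.+1)%N || ((idx v.+1).+1 < i)%N)}
       & {in l2, forall i, (0 < i < N)%N && ((i.+1 < idx v)%N || ((idx v).+1 < i)%N)}]) ->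
  {in J, forall j, {in lst j, forall i, rotation (rot_at m ac as_ j i)}} ->
  rotation (scr_rot m 0) ->
  (forall s' m' t', s' 0%N = s 0%N -> s' 1%N = s 1%N -> s' 2%N = s 2%N ->
     (t' <= t + 150 * s 1)%N ->
     (forall a j i, (a < 10)%N -> a != ac -> a != as_ -> m' a j i = m a j i) ->
     {in J, forall j, {in lst j, forall i, rotation (rot_at m' ac as_ j i)}} ->
     rotation (scr_rot m' 0) ->
     lines N lst ac as_ m J *m gv N (idx 0%N) (scr_rot m 0) =
     gv N (idx (s 1%N)) (scr_rot m' 0) *m lines N lst ac as_ m' J ->
     Q s' m' t') ->
  runs (For 3 (NVar 1) (turn_at b ac as_ ej eq1 eq2)) s m t Q.
Proof.
move=> ac10 as10 acas; move k_def: (s 1%N) => k sJ uJ He Hb HN Hl rJ r0 HQ.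
(* After v crossings the pending rotation stands just before the last v lines, and the whole product
   is what it was at the beginning. *)
pose I v s' m' t' := [/\ [/\ s' 0%N = s 0%N, s' 1%N = s 1%N & s' 2%N = s 2%N],
  (t' <= t + 150 * v)%N,
  (forall a j i, (a < 10)%N -> a != ac -> a != as_ -> m' a j i = m a j i),
  {in J, forall j, {in lst j, forall i, rotation (rot_at m' ac as_ j i)}} /\
  rotation (scr_rot m' 0)
  & lines N lst ac as_ m' (take (k - v) J) *m gv N (idx v) (scr_rot m' 0) *m
     lines N lst ac as_ m' (drop (k - v) J) =
    lines N lst ac as_ m J *m gv N (idx 0%N) (scr_rot m 0)].
have I0 : I 0%N s m t.
  split=> //; first by rewrite muln0 addn0.
  by rewrite subn0 -sJ take_size drop_size /lines big_nil mulmx1.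
apply: runs_conseq (runs_for (v := 3) (e := NVar 1) I0 _); rewrite /= k_def.
  move=> s' m' t' [[s0 s1 s2] tt fr [rl r] E]; apply: HQ => //; first by rewrite s1.
  by rewrite -E subnn take0 drop0 /lines big_nil mul1mx.
move=> v s' m' t' vk [[s0 s1 s2] tt fr [rl r] E].
have [||||ej1 eq11 eq21] := He v vk (upd_var s' 3 v).
1-4: by rewrite /upd_var /= ?s1.
have [l1 [l2 [lE H1 H2]]] := Hl v vk.
set j := nth 0%N J _ in ej1 lE.
have kv : (k - v)%N = (k - v.+1).+1 by lia.
have kvJ : (k - v.+1 < size J)%N by rewrite sJ; lia.
have jJ : j \in J by apply: mem_nth.
have JE : J = take (k - v.+1) J ++ j :: drop (k - v) J.
  by rewrite kv -(drop_nth 0%N) // cat_take_drop.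
(* As [J] has no repetition, rewriting line j leaves the other lines intact. *)
have [jT jD] : j \notin take (k - v.+1) J /\ j \notin drop (k - v) J.
  move: uJ; rewrite {1}JE cat_uniq /= negb_or => /and3P[_ /andP[jT _]].
  by case/andP.
apply: (@runs_turn_line N _ _ _ _ _ _ (lst j) l1 l2) => //; rewrite ?ej1 ?eq11 ?eq21 //.
- exact: Hb.
- by apply: HN; lia.
- by apply: HN.
- exact: rl.
move=> m2 t2 t2t fr2 rl2 r2 E2; split.
- by rewrite /upd_var.
- by lia.
- move=> a j' i a10 a1 a2; rewrite fr2 ?fr //.
  by rewrite (negbTE a1) (negbTE a2).
- split=> // j' j'J i il; have [jj|jj] := eqVneq j' j.
    by move: il; rewrite jj; apply: rl2.
  have -> : rot_at m2 ac as_ j' i = rot_at m' ac as_ j' i; last exact: rl.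
  by congr (_, _); rewrite fr2 // (negbTE jj) andbF.
- have same J' : j \notin J' -> lines N lst ac as_ m2 J' = lines N lst ac as_ m' J'.
    move=> jJ'; apply: eq_lines => j' i j'J'.
    have jj : (j' == j) = false by apply/eqP => jj; rewrite -jj j'J' in jJ'.
    by rewrite !fr2 // jj andbF.
  have dE : drop (k - v.+1) J = j :: drop (k - v) J by rewrite (drop_nth 0%N) // -kv.
  have tE : take (k - v) J = rcons (take (k - v.+1) J) j.
    by rewrite kv (take_nth 0%N).
  rewrite -E dE tE -cats1.
  rewrite -[_ :: _]cat1s !lines_cat !lines1 !same //.
  by rewrite -!mulmxA; congr (_ *m _); rewrite !mulmxA E2.
Qed.

End Sweeps.

(** * The programs of one QR step *)

Definition nvar : nexpr := NVar 0.
Definition kvar : nexpr := NVar 1.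
Definition ivar : nexpr := NVar 2.
Definition vvar : nexpr := NVar 3.
Definition nplus (e : nexpr) (x : nat) : nexpr := NAdd e (NLit x).

(* Index of the pending rotation while it stands next to Q. *)
Definition mid : nexpr := nplus (NAdd kvar ivar) 1.

(** From the right, L_k is met first. Its lines are descending, so the index falls by one on each of
    them, from k + i + 1 to i + 1. *)
Definition pass_L : cmd := For 3 kvar
  (turn_at true 1 2 (NSub kvar vvar) (nplus (NAdd ivar (NSub kvar vvar)) 1)
     (NAdd ivar (NSub kvar vvar))).

(** From the right, H_1 is met first, and the ascending lines raise the index back from i + 1 to k +
    i + 1. *)
Definition pass_R : cmd := For 3 kvar
  (turn_at false 3 4 (nplus vvar 1) (nplus (NAdd ivar vvar) 1)
     (nplus (NAdd ivar vvar) 2)).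

Definition update_Z : cmd := For 3 kvar (seqs [::
  set_scr 2 (CAdd (CMul (CConj (scr 0)) (CLoc 9 mid (nplus vvar 1)))
                  (CMul (CConj (scr 1)) (CLoc 9 (nplus mid 1) (nplus vvar 1))));
  CSet 9 (nplus mid 1) (nplus vvar 1)
    (CSub (CMul (scr 0) (CLoc 9 (nplus mid 1) (nplus vvar 1)))
          (CMul (scr 1) (CLoc 9 mid (nplus vvar 1))));
  CSet 9 mid (nplus vvar 1) (scr 2)]).

Definition pass_D : cmd :=
  set_scr 1 (CMul (CMul (scr 1) (CLoc 7 (NLit 0) (nplus mid 1)))
                  (CConj (CLoc 7 (NLit 0) mid))).

(** The new cosine waits in a scratch cell, because the formula for the sine may still read the cell
    it will replace. *)
Definition fuse (gc gs hc hs : cexpr) (p : nexpr) : cmd := seqs [::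
  set_scr 2 (CSub (CMul gc hc) (CMul (CConj gs) hs));
  CSet 6 (NLit 0) p (CAdd (CMul gs hc) (CMul (CConj gc) hs));
  CSet 5 (NLit 0) p (scr 2)].

Definition Q_cos (p : nexpr) : cexpr := CLoc 5 (NLit 0) p.
Definition Q_sin (p : nexpr) : cexpr := CLoc 6 (NLit 0) p.

(** The turnover in Q needs a factor of index k + i + 2, which exists exactly when i + 3 <= n.
    Otherwise the pending rotation has the index of the last factor of Q and is multiplied into
    it. *)
Definition chase_step : cmd := seqs [:: pass_L; pass_R; update_Z; pass_D;
  IfLeq (nplus ivar 3) nvar
    (turn_at false 5 6 (NLit 0) mid (nplus mid 1))
    (fuse (Q_cos mid) (Q_sin mid) (scr 0) (scr 1) mid)].

(** Cells 2 and 3 accumulate the entries of R e_1 and L^H e_1 at 0-based position k; cells 9 and 10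
    receive the two surviving entries of L^H x. The first factor of Q is finally multiplied by the
    adjoint of the pending rotation. *)
Definition start : cmd := seqs [::
  set_scr 2 (CLit 1); set_scr 3 (CLit 1);
  For 3 kvar (seqs [::
    set_scr 2 (CMul (scr 2) (CLoc 4 (nplus vvar 1) (nplus vvar 1)));
    set_scr 3 (CMul (scr 3)
      (CSub (CLit 0) (CLoc 2 (nplus vvar 1) (nplus vvar 1))))]);
  set_scr 9 (CSub
    (CMul (CMul (Q_cos (nplus kvar 1)) (CLoc 7 (NLit 0) (nplus kvar 1))) (scr 2))
    (CMul (CLoc 0 (NLit 0) (NLit 0)) (scr 3)));
  set_scr 10
    (CMul (CMul (Q_sin (nplus kvar 1)) (CLoc 7 (NLit 0) (nplus kvar 1))) (scr 2));
  normalize; set_scr 0 (scr 15); set_scr 1 (scr 16);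
  fuse (CConj (scr 0)) (CSub (CLit 0) (scr 1))
    (Q_cos (nplus kvar 1)) (Q_sin (nplus kvar 1)) (nplus kvar 1)].

Definition qr_algorithm : cmd := IfLeq nvar (NLit 1) Skip
  (Seq start (For 2 (NSub nvar (NLit 1)) chase_step)).

(** * Effect and cost of the passes through L, R and Z *)

Section Algorithm.
Variables (C : numClosedFieldType) (n k : nat).
Notation N := (n + k)%N.
Implicit Types (s : nat -> nat) (m : memory C) (t : nat).
Implicit Type Q : (nat -> nat) -> memory C -> nat -> Prop.

Lemma stored_L_lines m : stored_L n k m =
  lines N (fun j => rev (index_iota j (n + j))) 1 2 m (index_iota 1 k.+1).
Proof. by []. Qed.

Lemma stored_R_lines m : stored_R n k m =
  lines N (fun j => index_iota j N) 3 4 m (rev (index_iota 1 k.+1)).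
Proof. by []. Qed.

Lemma eq_stored_L m m' : (forall i j, m 1%N i j = m' 1%N i j) ->
  (forall i j, m 2%N i j = m' 2%N i j) -> stored_L n k m = stored_L n k m'.
Proof. by move=> e1 e2; rewrite !stored_L_lines; apply: eq_lines. Qed.

Lemma eq_stored_R m m' : (forall i j, m 3 i j = m' 3 i j) ->
  (forall i j, m 4 i j = m' 4 i j) -> stored_R n k m = stored_R n k m'.
Proof. by move=> e1 e2; rewrite !stored_R_lines; apply: eq_lines. Qed.

Lemma eq_stored_D m m' : (forall i j, m 7 i j = m' 7 i j) ->
  diag_mx (\row_(i < N) m 7 0%N i.+1) = diag_mx (\row_(i < N) m' 7 0%N i.+1).
Proof. by move=> e; congr diag_mx; apply/rowP => i; rewrite !mxE. Qed.

Lemma eq_stored_Z m m' : (forall i j, m 9 i j = m' 9 i j) ->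
  stored_Z n k m = stored_Z n k m'.
Proof. by move=> e; apply/matrixP => i j; rewrite !mxE. Qed.

Lemma eq_stored_Tk m m' : (forall i j, m 8 i j = m' 8 i j) ->
  stored_Tk k m = stored_Tk k m'.
Proof. by move=> e; apply/matrixP => i j; rewrite !mxE. Qed.

Lemma eq_stored_T m m' : (forall i j, m 8 i j = m' 8 i j) ->
  stored_T n k m = stored_T n k m'.
Proof. by move=> e; rewrite /stored_T (eq_stored_Tk e). Qed.

Lemma runs_pass_L i s m t Q : s 0%N = n -> s 1%N = k -> s 2%N = i -> (i.+1 < n)%N ->
  stored_rotations n k m -> rotation (scr_rot m 0) ->
  (forall s' m' t', s' 0%N = n -> s' 1%N = k -> s' 2%N = i -> (t' <= t + 150 * k)%N ->
     (forall a j l, (a < 10)%N -> a != 1%N -> a != 2%N -> m' a j l = m a j l) ->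
     stored_rotations n k m' -> rotation (scr_rot m' 0) ->
     stored_L n k m *m gv N (k + i).+1 (scr_rot m 0) =
     gv N i.+1 (scr_rot m' 0) *m stored_L n k m' -> Q s' m' t') ->
  runs pass_L s m t Q.
Proof.
move=> s0 s1 s2 iN [rL rH rQ rD] r0 HQ.
apply: (@runs_pass _ N true 1%N 2%N _ _ _ (fun j => rev (index_iota j (n + j)))
  (index_iota 1 k.+1) (fun v => (i + (k - v)).+1)) => //.
- by rewrite size_iota s1 subn1.
- exact: iota_uniq.
- move=> v; rewrite s1 => vk s' _ /= -> -> ->; rewrite s2.
  by rewrite nth_iota; last (by lia); split; lia.
- by move=> v; rewrite s1; lia.
- by move=> v; rewrite s1; lia.
- move=> v; rewrite s1 => vk; rewrite nth_iota; last by lia.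
  (* Of the factors of L_j, only those of index i + j + 1 and i + j take part in the turnover; both
     are present because i + 1 < n. *)
  set j := (1 + _)%N; exists (rev (index_iota (i + j + 2) (n + j))).
  exists (rev (index_iota j (i + j))); split.
  + rewrite (@index_iota_cat j (i + j)); last by lia.
    rewrite (@index_iota_cons (i + j)); last by lia.
    rewrite (@index_iota_cons (i + j).+1); last by lia.
    rewrite rev_cat !rev_cons -!cats1 -!catA /= addn2.
    have -> : (i + (k - v) = i + j)%N by rewrite /j; lia.
    by have -> : ((i + (k - v.+1)).+1 = i + j)%N by rewrite /j; lia.
  + by move=> x; rewrite mem_rev mem_index_iota /j; lia.
  + by move=> x; rewrite mem_rev mem_index_iota /j; lia.
- move=> j; rewrite mem_index_iota => jk l; rewrite mem_rev mem_index_iota => lj.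
  by apply: rL; lia.
move=> s' m' t' s0' s1' s2' tt fr rl r E.
rewrite s0 s1 s2 in s0' s1' s2' tt E.
apply: (HQ s' m' t') => //.
  split.
  - move=> j l jk lj; apply: (rl j); rewrite ?mem_rev mem_index_iota; lia.
  - by move=> j l jk lj; rewrite !fr //; apply: rH.
  - by move=> l lj; rewrite !fr //; apply: rQ.
  - by move=> l lj; rewrite !fr //; apply: rD.
rewrite subn0 subnn addn0 in E.
by rewrite !stored_L_lines [(k + i)%N]addnC.
Qed.

Lemma runs_pass_R i s m t Q : s 0%N = n -> s 1%N = k -> s 2%N = i -> (i.+1 < n)%N ->
  stored_rotations n k m -> rotation (scr_rot m 0) ->
  (forall s' m' t', s' 0%N = n -> s' 1%N = k -> s' 2%N = i -> (t' <= t + 150 * k)%N ->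
     (forall a j l, (a < 10)%N -> a != 3 -> a != 4 -> m' a j l = m a j l) ->
     stored_rotations n k m' -> rotation (scr_rot m' 0) ->
     stored_R n k m *m gv N i.+1 (scr_rot m 0) =
     gv N (k + i).+1 (scr_rot m' 0) *m stored_R n k m' -> Q s' m' t') ->
  runs pass_R s m t Q.
Proof.
move=> s0 s1 s2 iN [rL rH rQ rD] r0 HQ.
apply: (@runs_pass _ N false 3 4 _ _ _ (fun j => index_iota j N)
  (rev (index_iota 1 k.+1)) (fun v => (i + v).+1)) => //.
- by rewrite size_rev size_iota s1 subn1.
- by rewrite rev_uniq iota_uniq.
- move=> v; rewrite s1 => vk s' _ _ /= -> ->; rewrite s2.
  by rewrite nth_rev size_iota ?nth_iota; try split; lia.
- by move=> v; rewrite s1 addnS.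
- by move=> v; rewrite s1; lia.
- move=> v; rewrite s1 => vk; rewrite nth_rev size_iota ?nth_iota; try lia.
  set j := (1 + _)%N; exists (index_iota j (i + j)), (index_iota (i + j + 2) N); split.
  + rewrite (@index_iota_cat j (i + j)); last by rewrite /j; lia.
    rewrite (@index_iota_cons (i + j)); last by rewrite /j; lia.
    rewrite (@index_iota_cons (i + j).+1); last by rewrite /j; lia.
    by rewrite addn2 addnS; have -> : (i + j = (i + v).+1)%N by rewrite /j; lia.
  + by move=> x; rewrite mem_index_iota /j; lia.
  + by move=> x; rewrite mem_index_iota /j; lia.
- move=> j; rewrite mem_rev mem_index_iota => jk l; rewrite mem_index_iota => lj.
  by apply: rH; lia.
move=> s' m' t' s0' s1' s2' tt fr rl r E.
rewrite s0 s1 s2 in s0' s1' s2' tt E.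
apply: (HQ s' m' t') => //.
  split.
  - by move=> j l jk lj; rewrite !fr //; apply: rL.
  - move=> j l jk lj; apply: (rl j); rewrite ?mem_rev mem_index_iota; lia.
  - by move=> l lj; rewrite !fr //; apply: rQ.
  - by move=> l lj; rewrite !fr //; apply: rD.
rewrite addn0 in E.
by rewrite !stored_R_lines [(k + i)%N]addnC.
Qed.

Lemma runs_update_Z i s m t Q : s 0%N = n -> s 1%N = k -> s 2%N = i -> (i.+1 < n)%N ->
  (forall s' m' t', s' 0%N = n -> s' 1%N = k -> s' 2%N = i -> (t' <= t + 10 * k)%N ->
     (forall a j l, (a < 10)%N -> a != 9 -> m' a j l = m a j l) ->
     scr_rot m' 0 = scr_rot m 0 ->
     stored_Z n k m' = (gv N (k + i).+1 (scr_rot m 0))^t* *m stored_Z n k m ->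
     Q s' m' t') ->
  runs update_Z s m t Q.
Proof.
move=> s0 s1 s2 iN; move pE: (k + i).+1 => p HQ.
(* Entries of the adjoint rotation applied to Z, with 1-based indices. The loop treats one column at
   a time, so the invariant has this value in columns 1 to v. *)
pose newZ r l := if r == p then (m 10 0 0)^* * m 9 p l + (m 10 0 1)^* * m 9 p.+1 l
  else if r == p.+1 then m 10 0 0 * m 9 p.+1 l - m 10 0 1 * m 9 p l else m 9 r l.
pose I v s' m' t' := [/\ [/\ s' 0%N = n, s' 1%N = k & s' 2%N = i],
  (t' <= t + 10 * v)%N,
  (forall a j l, (a < 10)%N -> a != 9 -> m' a j l = m a j l),
  m' 10 0 0 = m 10 0 0 /\ m' 10 0 1 = m 10 0 1
  & forall r l, m' 9 r l = if (0 < l <= v)%N then newZ r l else m 9 r l].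
have I0 : I 0%N s m t.
  split=> //; first by lia.
  by move=> r l; case: ifP => //; lia.
apply: runs_conseq (runs_for (v := 3) (e := kvar) I0 _); rewrite /= s1.
  move=> s' m' t' [[s0' s1' s2'] tt fr [c0 c1] Z]; apply: (HQ s' m' t') => //.
    by rewrite /scr_rot c0 c1.
  have entZ9 (m1 : memory C) j a : (a < N)%N -> ent (stored_Z n k m1) j a = m1 9 a.+1 j.+1.
    by move=> aN; rewrite /ent insubT mxE.
  apply/matrixP => r l; rewrite -!ent_ord gv_adj ent_gv; last by lia.
  have pN : (p < N)%N by lia.
  rewrite [LHS]entZ9 // Z ltn_ord /= /newZ eqSS.
  case: eqP => [rp|rp].
    rewrite !entZ9 ?rp ?(ltnW pN) // /rot1 /=.
    by conj_simpl; ring.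
  case: eqP => [rp'|rp'].
    rewrite !entZ9 //; last by rewrite -rp' in pN; lia.
    rewrite rp' /rot2 /= prednK; last by lia.
    by conj_simpl; ring.
  by rewrite entZ9.
move=> v s' m' t' vk [[s0' s1' s2'] tt fr [c0 c1] Z].
apply: runs_seq; apply: runs_cset => [//|x ex]; move: ex.
rewrite /= /upd_var /= s1' s2' !addn1 pE => ex.
apply: runs_seq; apply: runs_cset => [//|y ey]; move: ey.
rewrite /= /upd_var /= s1' s2' !addn1 pE => ey.
apply: runs_seq; apply: runs_cset => [//|z ez]; move: ez.
rewrite /= /upd_var /= s1' s2' !addn1 pE => ez.
apply: runs_skip.
have exN : x = newZ p v.+1.
  by rewrite ex /newZ eqxx !Z c0 c1; (case: ifP => [|_]; first by lia).
have eyN : y = newZ p.+1 v.+1.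
  rewrite ey /newZ eqxx /upd_mem /= !Z c0 c1; (case: ifP => [|_]; first by lia).
  by case: eqP => //; lia.
split.
- by [].
- by rewrite /=; lia.
- move=> a j l a10 a9; rewrite /upd_mem (negbTE a9) /=.
  by case: eqP => [|_]; [lia | rewrite fr].
- by [].
- move=> r l; rewrite {1}/upd_mem /= ez.
  have zx : upd_mem (upd_mem m' 10 0 2 x) 9 p.+1 v.+1 y 10 0 2 = x.
    by rewrite /upd_mem.
  rewrite zx /upd_mem /=.
  have [->|rp] := eqVneq r p; have [->|lv] := eqVneq l v.+1 => /=.
  + by rewrite ltnSn -exN.
  + by rewrite Z andbF; do 2?case: ifP => //; lia.
  + rewrite ltnSn; case: eqP => [->|rp']; first by rewrite -eyN.
    rewrite /= Z /newZ (negbTE rp); case: eqP => // _.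
    by case: ifP.
  + by rewrite andbF Z; do 2?case: ifP => //; lia.
Qed.

End Algorithm.

(** * The initial rotation and one sweep *)

Section ChaseStep.
Variables (C : numClosedFieldType) (n k : nat).
Notation N := (n + k)%N.
Implicit Types (s : nat -> nat) (m : memory C) (t : nat).
Implicit Type Q : (nat -> nat) -> memory C -> nat -> Prop.

Definition Q_rotations m := rowprod N (index_iota k.+1 N) (m 5 0%N) (m 6 0%N).
Definition Q_diagonal m : 'M[C]_N := diag_mx (\row_(i < N) m 7 0%N i.+1).

Lemma runs_pass_D i s m t Q : s 1%N = k -> s 2%N = i -> (i.+1 < n)%N ->
  stored_rotations n k m -> rotation (scr_rot m 0) ->
  (forall m' t', (t' <= t + 5)%N ->
     (forall a j l, (a < 10)%N -> m' a j l = m a j l) -> rotation (scr_rot m' 0) ->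
     Q_diagonal m *m gv N (k + i).+1 (scr_rot m 0) =
     gv N (k + i).+1 (scr_rot m' 0) *m Q_diagonal m -> Q s m' t') ->
  runs pass_D s m t Q.
Proof.
move=> s1 s2 iN [_ _ _ rD] r0 HQ; apply: runs_cset => [//|x ex].
rewrite /= s1 s2 !addn1 in ex.
have d1 : `|m 7 0%N (k + i).+1| = 1 by apply: rD; lia.
have d2 : `|m 7 0%N (k + i).+2| = 1 by apply: rD; lia.
apply: HQ.
- by rewrite /=; lia.
- by move=> a j l a10; rewrite /upd_mem; case: eqP => // ?; lia.
- move: r0; rewrite /rotation /is_rotation /scr_rot /upd_mem /= ex.
  by rewrite !normrM norm_conjC d1 d2 !mulr1.
rewrite /Q_diagonal (@diag_gv _ N (k + i).+1 (m 7 0%N)) //; last by lia.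
by rewrite /scr_rot /upd_mem /= ex.
Qed.

(** The operands must keep their values when scratch cells from 2 on change; they may read the
    pending rotation in cells 0 and 1. *)
Lemma runs_fuse gc gs hc hs p g h s m t Q :
  (forall m1, (forall a i j, (a != 10%N) || (j < 2)%N -> m1 a i j = m a i j) ->
     [/\ ceval s m1 gc = Some g.1, ceval s m1 gs = Some g.2 &
         ceval s m1 hc = Some h.1]) ->
  (forall m1, (forall a i j, (a != 10%N) || (j < 2)%N -> m1 a i j = m a i j) ->
     ceval s m1 hs = Some h.2) ->
  (arith_ops gc + arith_ops gs + arith_ops hc + arith_ops hs <= 4)%N ->
  (forall m' t', (t' <= t + 20)%N ->
     (forall a i j, (a < 10)%N ->
        ~~ [&& (a == 5) || (a == 6), i == 0%N & j == neval s p] ->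
        m' a i j = m a i j) ->
     scr_rot m' 0 = scr_rot m 0 -> rot_at m' 5 6 0 (neval s p) = rotmul g h ->
     Q s m' t') ->
  runs (fuse gc gs hc hs p) s m t Q.
Proof.
move=> H1 H2 ops HQ.
have [a1 a2 a3] := H1 m (fun _ _ _ _ => erefl); have a4 := H2 m (fun _ _ _ _ => erefl).
apply: runs_seq; apply: runs_cset; first by rewrite /= a1 /= a2 /= a3 /= a4.
move=> x ex.
set m1 := upd_mem _ _ _ _ _.
have fr a i j : (a != 10%N) || (j < 2)%N -> m1 a i j = m a i j.
  by rewrite /m1 /upd_mem; case: eqP => //= _; case: eqP => //= _; case: eqP => //= ->.
have [{}a1 {}a2 {}a3] := H1 m1 fr; have {}a4 := H2 m1 fr.
apply: runs_seq; apply: runs_cset; first by rewrite /= a1 /= a2 /= a3 /= a4.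
move=> y ey; apply: runs_seq; apply: runs_cset; first by [].
move=> z; rewrite {1}/upd_mem /= => ez; rewrite {1}/m1 /upd_mem /= in ez.
apply: runs_skip; apply: HQ.
- by rewrite /=; lia.
- move=> a i j a10; rewrite /upd_mem /= => /negbTE nai.
  have -> : m a i j = m1 a i j by rewrite fr //; apply/orP; left; lia.
  by move: nai; case: (a == 5); case: (a == 6) => //= ->.
- by rewrite /scr_rot /upd_mem /= !fr.
- by rewrite /rot_at /upd_mem /= !eqxx /= ez ex ey.
Qed.

Lemma Q_rotations_cons m : (1 < n)%N -> Q_rotations m =
  gv N k.+1 (rot_at m 5 6 0 k.+1) *m
  rowprod N (index_iota k.+2 N) (m 5 0%N) (m 6 0%N).
Proof. by move=> n1; rewrite /Q_rotations index_iota_cons ?rowprod_cons //; lia. Qed.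

Lemma runs_start s m t Q : s 0%N = n -> s 1%N = k -> (1 < n)%N -> (0 < k)%N ->
  stored_rotations n k m ->
  (forall s' m' t', s' 0%N = n -> s' 1%N = k -> (t' <= t + 70 * k)%N ->
     (forall a i j, (a < 10)%N -> a != 5 -> a != 6 -> m' a i j = m a i j) ->
     stored_rotations n k m' -> rotation (scr_rot m' 0) ->
     let r := \prod_(1 <= j < k.+1) m 4 j j in
     let l := \prod_(1 <= j < k.+1) - m 2 j j in
     let z1 := m 5 0 k.+1 * m 7 0 k.+1 * r - m 0 0 0 * l in
     let z2 := m 6 0 k.+1 * m 7 0 k.+1 * r in
     (scr_rot m' 0).1 * z2 = (scr_rot m' 0).2 * z1 ->
     gv N k.+1 (scr_rot m' 0) *m stored_Q n k m' = stored_Q n k m ->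
     Q s' m' t') ->
  runs start s m t Q.
Proof.
move=> s0 s1 n1 k0 rm HQ; rewrite /start /seqs [foldr _ _ _]/=.
assign r0 er0; assign l0 el0; apply: runs_seq.
pose I v s' m' t' := [/\ s' 0%N = n /\ s' 1%N = k, (t' <= t + 5 * v)%N,
  (forall a i j, (a < 10)%N -> m' a i j = m a i j),
  m' 10 0 2 = \prod_(1 <= j < v.+1) m 4 j j
  & m' 10 0 3 = \prod_(1 <= j < v.+1) - m 2 j j].
have I0 : I 0%N s (upd_mem (upd_mem m 10 0 2 r0) 10 0 3 l0) (t + 0 + 0)%N.
  split=> //; first by lia.
  - by move=> a i j a10; rewrite /upd_mem; case: eqP => // ?; lia.
  - by rewrite big_nil er0.
  - by rewrite big_nil el0.
apply: runs_conseq (runs_for (v := 3) (e := kvar) I0 _); rewrite /= s1; last first.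
  move=> v s' m' t' vk [[s0' s1'] tt fr R L].
  apply: runs_seq; apply: runs_cset => [//|x ex]; move: ex.
  rewrite /= /upd_var /= !addn1 R fr // => ex.
  apply: runs_seq; apply: runs_cset => [//|y ey]; move: ey.
  rewrite /= /upd_var /= !addn1 {1 2}/upd_mem /= L fr // sub0r => ey.
  apply: runs_skip; split.
  - by [].
  - by rewrite /=; lia.
  - by move=> a i j a10; rewrite /upd_mem; case: eqP => [?|_]; [lia | rewrite fr].
  - by rewrite /upd_mem /= ex [RHS]big_nat_recr.
  - by rewrite /upd_mem /= ey [RHS]big_nat_recr.
move=> {I I0} s' m1 t1 [[s0' s1'] tt fr R L].
apply: runs_seq; apply: runs_cset => [//|z1]; rewrite /= s1' addn1 R L !fr // => e1.
apply: runs_seq; apply: runs_cset => [//|z2].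
rewrite /= s1' addn1 /upd_mem /= R !fr // -/(upd_mem m1 10 0 9 z1) => e2.
apply: runs_seq; apply: runs_normalize => m2 t2 t2t fr2 rg rr z1E z2E.
assign c0 ec; assign c1 es; set m3 := upd_mem (upd_mem m2 _ _ _ _) _ _ _ _.
have fr3 a i j : (a < 10)%N -> m3 a i j = m a i j.
  move=> a10; have a10' : (a == 10%N) = false by apply/eqP; lia.
  by rewrite /m3 /upd_mem a10' /= fr2 ?a10' //= /upd_mem ?a10' /= fr.
have X : scr_rot m3 0 = scr_rot m2 15 by rewrite /scr_rot /m3 /upd_mem /= ec es.
rewrite /upd_mem /= in z1E z2E.
have kN : (0 < k.+1 < N)%N by lia.
have [rL rH rQ rD] := rm.
have rQk : rotation (rot_at m 5 6 0 k.+1) by apply: rQ; lia.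
(* Q' arises from Q by multiplying its first rotation on the left by the adjoint of X, so X Q' =
   Q. *)
apply: runs_seq; apply: (runs_fuse (g := adj (scr_rot m3 0)) (h := rot_at m 5 6 0 k.+1)).
- move=> m4 fr4; rewrite /= !fr4 // s1' addn1 (fr3 5%N) //; split=> //.
  by rewrite sub0r.
- by move=> m4 fr4; rewrite /= !fr4 // s1' addn1 (fr3 6%N).
- by [].
rewrite /= s1' addn1 => m4 t4 t4t fr4 X4 Q4.
apply: runs_skip; have rX : rotation (scr_rot m4 0) by rewrite X4 X.
apply: HQ => //.
- by rewrite /= in t2t t4t *; lia.
- move=> a i j a10 a5 a6; rewrite fr4 ?fr3 //.
  by rewrite (negbTE a5) (negbTE a6).
- split.
  + by move=> j l jk lj; rewrite !fr4 ?fr3 //; apply: rL.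
  + by move=> j l jk lj; rewrite !fr4 ?fr3 //; apply: rH.
  + move=> l lj; have [->|lk] := eqVneq l k.+1.
      rewrite -/(rotation (rot_at m4 5 6 0 k.+1)) Q4.
      by apply: rotmul_rotation => //; apply: adj_rotation; rewrite X.
    by rewrite !fr4 ?fr3 ?(negbTE lk) ?andbF //; apply: rQ.
  + by move=> l lj; rewrite !fr4 ?fr3 //; apply: rD.
- rewrite X4 X -e1 -e2 z1E z2E /=; ring.
rewrite !stored_QE -!/(Q_rotations _) !Q_rotations_cons //.
have -> : diag_mx (\row_(i < N) m4 7 0%N i.+1) = diag_mx (\row_(i < N) m 7 0%N i.+1).
  by apply: eq_stored_D => i j; rewrite fr4 ?fr3.
rewrite !mulmxA; congr (_ *m _).
have -> : rowprod N (index_iota k.+2 N) (m4 5 0%N) (m4 6 0%N) =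
    rowprod N (index_iota k.+2 N) (m 5 0%N) (m 6 0%N).
  have out l : l \in index_iota k.+2 N -> (l == k.+1) = false.
    by rewrite mem_index_iota; case: eqP => // ->; lia.
  by apply: eq_rowprod => l /out lk; rewrite fr4 ?fr3 ?lk ?andbF.
rewrite Q4 -gv_mul // -gv_adj X4 !mulmxA unitary_adjr ?mul1mx //.
by apply: gv_unitary => //; rewrite X.
Qed.

(** Before sweep i the pending rotation has index k + i + 1; at i = n - 1 none is left. T refers to
    the initial memory, and array 8 is recorded as unchanged. *)
Definition chase_invariant (mu : C) (A : 'M[C]_N) m0 t0 i s m t : Prop :=
  [/\ s 0%N = n /\ s 1%N = k, (t <= t0 + i * (600 * k))%N,
     stored_rotations n k m, (forall j l, m 8 j l = m0 8 j l)
   & if (i.+1 < n)%N then rotation (scr_rot m 0) /\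
       chased mu A (stored_T n k m0)
         (stored_L n k m *m gv N (k + i).+1 (scr_rot m 0))
         (stored_Q n k m) (stored_R n k m) (stored_Z n k m)
     else chased mu A (stored_T n k m0) (stored_L n k m)
         (stored_Q n k m) (stored_R n k m) (stored_Z n k m)].

Lemma gv_T q g m : (k < q)%N -> (q < N)%N ->
  gv N q g *m stored_T n k m = stored_T n k m.
Proof.
move=> kq qN; apply: entP => j a; rewrite ent_gv; last by lia.
rewrite -[stored_T n k m]mulmx1.
case: eqP => [ak|ak]; first by rewrite !ent_TM /rot1 ?mulr0 ?subr0 //; lia.
case: eqP => [ak'|//]; rewrite !ent_TM /rot2 ?mulr0 ?addr0 //; lia.
Qed.

Lemma gv_adj_supp q g (M : 'cV[C]_N) : (k.+1 < q)%N -> (q < N)%N ->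
  supp k (ent M ord0) -> supp k (ent ((gv N q g)^t* *m M) ord0).
Proof.
move=> kq qN sM a ka; rewrite gv_adj ent_gv; last by lia.
case: eqP => [ak|ak]; first by rewrite !sM /rot1 ?mulr0 ?subr0 //; lia.
case: eqP => [ak'|_]; last exact: sM.
rewrite !(sM a, sM a.-1) /rot2 ?mulr0 ?addr0 //; lia.
Qed.

Lemma runs_chase_step mu A m0 t0 i s m t : (i.+1 < n)%N -> (0 < k)%N ->
  chase_invariant mu A m0 t0 i s m t ->
  runs chase_step (upd_var s 2 i) m t (chase_invariant mu A m0 t0 i.+1).
Proof.
move=> iN k0 [[s0 s1] tt rm T8]; rewrite iN => -[r0 ch].
rewrite /chase_step /seqs [foldr _ _ _]/=; apply: runs_seq.
apply: (@runs_pass_L C n k i) => // sa ma ta sa0 sa1 sa2 tta fra rma ra EL.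
apply: runs_seq; apply: (@runs_pass_R C n k i) => //.
move=> sb mb tb sb0 sb1 sb2 ttb frb rmb rb ER.
apply: runs_seq; apply: (@runs_update_Z C n k i) => //.
move=> sc mc tc sc0 sc1 sc2 ttc frc pc EZ.
have rmc : stored_rotations n k mc.
  case: rmb => hL hH hQ hD; split.
  - by move=> j l jk lj; rewrite !frc //; apply: hL.
  - by move=> j l jk lj; rewrite !frc //; apply: hH.
  - by move=> l lj; rewrite !frc //; apply: hQ.
  - by move=> l lj; rewrite !frc //; apply: hD.
have rc : rotation (scr_rot mc 0) by rewrite pc.
apply: runs_seq; apply: (@runs_pass_D i) => // md td ttd frd rd ED.
rewrite pc in ED.
have [rLd rHd rQd rDd] : stored_rotations n k md.
  case: rmc => hL hH hQ hD; split.
  - by move=> j l jk lj; rewrite !frd //; apply: hL.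
  - by move=> j l jk lj; rewrite !frd //; apply: hH.
  - by move=> l lj; rewrite !frd //; apply: hQ.
  - by move=> l lj; rewrite !frd //; apply: hD.
(* Both ways of treating Q end with this argument; [Y] is the new pending rotation or the
   identity. *)
have stepQ me Y : (forall a j l, (a < 10)%N -> a != 5 -> a != 6 -> me a j l = md a j l) ->
  Q_rotations md *m gv N (k + i).+1 (scr_rot md 0) = Y *m Q_rotations me ->
  Y *m stored_T n k m0 = stored_T n k m0 ->
  (forall M : 'cV[C]_N, supp k (ent M ord0) -> supp k (ent (Y^t* *m M) ord0)) ->
  chased mu A (stored_T n k m0) (stored_L n k me *m Y)
    (stored_Q n k me) (stored_R n k me) (stored_Z n k me).
  move=> fre EQ YT sY.
  have -> : stored_L n k me = stored_L n k ma.
    by apply: eq_stored_L => j l; rewrite fre // frd // frc // frb.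
  have -> : stored_R n k me = stored_R n k mb.
    by apply: eq_stored_R => j l; rewrite fre // frd // frc.
  have -> : stored_Z n k me = (gv N (k + i).+1 (scr_rot mb 0))^t* *m stored_Z n k m.
    have -> : stored_Z n k me = stored_Z n k mc.
      by apply: eq_stored_Z => j l; rewrite fre // frd.
    by rewrite EZ; congr (_ *m _); apply: eq_stored_Z => j l; rewrite frb // fra.
  apply: (chased_step (B := gv N (k + i).+1 (scr_rot mb 0)) (i := i.+1)) ch => //.
  - exact: ra.
  - by apply: gv_unitary => //; lia.
  - exact: EL.
  - rewrite -ER; congr (_ *m _); apply: eq_stored_R => j l; by rewrite fra.
  - rewrite !stored_QE -!/(Q_rotations _).
    have -> : diag_mx (\row_(r < N) me 7 0%N r.+1) = Q_diagonal mc.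
      by apply: eq_stored_D => j l; rewrite fre // frd.
    have -> : diag_mx (\row_(r < N) m 7 0%N r.+1) = Q_diagonal mc.
      by apply: eq_stored_D => j l; rewrite frc // frb // fra.
    rewrite -mulmxA ED !mulmxA -EQ; congr (_ *m _ *m _).
    by apply: eq_rowprod => l _; rewrite frd // frc // frb // fra.
have T8d j l : md 8 j l = m0 8 j l by rewrite frd // frc // frb // fra.
(* The passes cost at most 310 k + 5 operations; 150 more are reserved for Q, and 310 k + 155 <= 600
   k as k is positive. *)
have td_le : (td + 150 <= t0 + i.+1 * (600 * k))%N by lia.
apply: runs_seq; apply: runs_ifleq; rewrite /= sc2 sc0 => iN2.
  set p := (k + i).+1 in stepQ.
  have iE : index_iota k.+1 N = index_iota k.+1 p ++ p :: p.+1 :: index_iota p.+2 N.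
    rewrite (@index_iota_cat k.+1 p); last by rewrite /p; lia.
    rewrite (@index_iota_cons p); last by rewrite /p; lia.
    by rewrite (@index_iota_cons p.+1) //; rewrite /p; lia.
  apply: (@runs_turn_line _ N _ _ _ _ _ _ (index_iota k.+1 N) (index_iota k.+1 p)
            (index_iota p.+2 N)) => //; rewrite /= ?sc1 ?sc2 ?addn1 -/p //.
  - by rewrite /p; lia.
  - by rewrite /p; lia.
  - by move=> x; rewrite mem_index_iota /p; lia.
  - by move=> x; rewrite mem_index_iota /p; lia.
  - by move=> x; rewrite mem_index_iota => xk; apply: rQd; lia.
  move=> me te tte fre rle re EQ; apply: runs_skip.
  have fre' a j l : (a < 10)%N -> a != 5 -> a != 6 -> me a j l = md a j l.
    by move=> a10 a5 a6; rewrite fre // (negbTE a5) (negbTE a6).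
  split.
  - by [].
  - by lia.
  - split.
    + by move=> j l jk lj; rewrite !fre' //; apply: rLd.
    + by move=> j l jk lj; rewrite !fre' //; apply: rHd.
    + by move=> l lj; apply: rle; rewrite mem_index_iota; lia.
    + by move=> l lj; rewrite fre' //; apply: rDd.
  - by move=> j l; rewrite fre'.
  case: ifP => [_|]; last by lia.
  split=> //; rewrite addnS -/p; apply: stepQ => //.
  - by apply: gv_T; rewrite /p; lia.
  - by move=> M; apply: gv_adj_supp; rewrite /p; lia.
(* Now i = n - 2, and the pending rotation is absorbed by the last factor of Q. *)
have pE : (k + i).+1 = N.-1 by lia.
apply: (runs_fuse (g := rot_at md 5 6 0 (k + i).+1) (h := scr_rot md 0)).
- move=> m1 fr1; rewrite /= sc1 sc2 addn1 !fr1 //.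
- by move=> m1 fr1; rewrite /= fr1.
- by [].
rewrite /= sc1 sc2 addn1 => me te tte fre _ EQ; apply: runs_skip.
have fre' a j l : (a < 10)%N -> a != 5 -> a != 6 -> me a j l = md a j l.
  by move=> a10 a5 a6; rewrite fre // (negbTE a5) (negbTE a6).
have rp : rotation (rot_at md 5 6 0 (k + i).+1) by apply: rQd; lia.
split.
- by [].
- by lia.
- split.
  + by move=> j l jk lj; rewrite !fre' //; apply: rLd.
  + by move=> j l jk lj; rewrite !fre' //; apply: rHd.
  + move=> l lj; have [->|lp] := eqVneq l (k + i).+1.
      by rewrite -/(rotation (rot_at me 5 6 0 _)) EQ; apply: rotmul_rotation.
    by rewrite !fre ?(negbTE lp) ?andbF //; apply: rQd.
  + by move=> l lj; rewrite fre' //; apply: rDd.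
- by move=> j l; rewrite fre'.
case: ifP => [|_]; first by lia.
rewrite -[stored_L n k me]mulmx1; apply: stepQ => //.
- rewrite mul1mx /Q_rotations (@index_iota_cat k.+1 (k + i).+1); last by lia.
  rewrite (@index_iota_cons (k + i).+1); last by lia.
  have N0 : (N - (k + i).+2 = 0)%N by lia.
  have -> : index_iota (k + i).+2 N = [::] by rewrite /index_iota N0.
  rewrite !rowprod_cat !rowprod_cons !rowprod_nil !mulmx1 -mulmxA.
  rewrite -[(me _ _ _, _)]/(rot_at me 5 6 0 (k + i).+1) EQ -gv_mul; last by lia.
  congr (_ *m _); apply: eq_rowprod => l; rewrite mem_index_iota => lk;
    by rewrite fre //; case: eqP => [?|_]; rewrite ?andbF //; lia.
- exact: mul1mx.
- by move=> M; rewrite trmxC1 mul1mx.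
Qed.

End ChaseStep.

(** * The complete QR step *)

Section Main.
Variables (C : numClosedFieldType) (n k : nat).
Notation N := (n + k)%N.

Lemma runs_qr_algorithm (mu : C) (A : 'M[C]_N) (m : memory C) s :
  s 0%N = n -> s 1%N = k -> (0 < n)%N -> (0 < k)%N -> stored_shift m = mu ->
  factored_format m A ->
  runs qr_algorithm s m 0 (fun _ m1 t1 => [/\ (t1 <= 700 * (n * k))%N,
    stored_rotations n k m1, (forall j l, m1 8 j l = m 8 j l) &
    chased mu A (stored_T n k m1) (stored_L n k m1) (stored_Q n k m1)
      (stored_R n k m1) (stored_Z n k m1)]).
Proof.
move=> s0 s1 n0 k0 smu fA; have [[rm dA] _ _ [_ [_ _ LT ZE]] AE] := fA.
apply: runs_ifleq; rewrite /= s0 => n1.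
  apply: runs_skip; split=> //.
  (* For n = 1 the identity is the similarity, and the support condition is vacuous because N = k +
     1. *)
  exists 1%:M; rewrite -scalar_mx_block; split=> //.
  - by apply/unitarymxP; rewrite mul1mx trmxC1.
  - by rewrite trmxC1 mul1mx mulmx1.
  - by move=> a ka; rewrite ent_out //; lia.
apply: runs_seq; apply: (@runs_start C n k) => //.
move=> s2 m2 t2 s20 s21 t2t fr rm2 r2 r l z1 z2 z12 EQ.
have ch : chased mu A (stored_T n k m) (stored_L n k m2 *m gv N k.+1 (scr_rot m2 0))
    (stored_Q n k m2) (stored_R n k m2) (stored_Z n k m2).
  have -> : stored_L n k m2 = stored_L n k m by apply: eq_stored_L => j i; rewrite fr.
  have -> : stored_R n k m2 = stored_R n k m by apply: eq_stored_R => j i; rewrite fr.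
  have -> : stored_Z n k m2 = stored_Z n k m by apply: eq_stored_Z => j i; rewrite fr.
  apply: (chased_init n1 k0 fA r2) => //.
  by move: z12; rewrite /z1 /z2 -smu.
have I0 : chase_invariant mu A m t2 0 s2 m2 t2.
  split=> //; first by rewrite mul0n addn0.
    by move=> j i; rewrite fr.
  by rewrite n1 addn0.
apply: runs_conseq (runs_for (v := 2) (e := NSub nvar (NLit 1)) I0 _).
  rewrite /= s20 => s' m' t' [_ tt rm' T8]; case: ifP => [|_ ch']; first by lia.
  have -> : stored_T n k m' = stored_T n k m by apply: eq_stored_T.
  split=> //; apply: (leq_trans tt).
  have -> : (n = (n - 1).+1)%N by lia.
  rewrite mulSn mulnDr; nia.
move=> i s' m' t'; rewrite /= s20 => iN; apply: runs_chase_step => //; lia.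
Qed.

End Main.

Theorem mainTheorem6 (R : realType) :
  exists (alg : cmd) (c : nat),
  forall (n k : nat) (mu : R[i]) (Ahat : 'M[R[i]]_(n + k)) (m : memory R[i]),
    (0 < n)%N -> (0 < k)%N ->
    stored_shift m = mu ->
    upper_hess 1 Ahat ->
    proper_upper_hess 1 (ulsubmx Ahat) ->
    factored_format m Ahat ->
    proper_upper_hess k (stored_R n k m) ->
    exists (m1 : memory R[i]) (ops : nat) (Ahat1 : 'M[R[i]]_(n + k)),
      [/\ run alg n k m = Some (m1, ops),
          (ops <= c * (n * k))%N,
          qr_step mu Ahat Ahat1,
          factored_format m1 Ahat1
        & ~~ eigenvalue (ulsubmx Ahat) mu ->
          proper_upper_hess 1 (ulsubmx Ahat1)].
Proof.
(* The start costs at most 70 k and each of the n - 1 sweeps at most 600 k. *)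
exists qr_algorithm, 700%N => n k mu A m n0 k0 smu _ pA fA _.
pose s0 v := nth 0%N [:: n; k] v.
have [s1 [m1 [t1 [e [t1t rm1 T8 ch]]]]] :=
  @runs_qr_algorithm _ n k mu A m s0 erefl erefl n0 k0 smu fA.
have [[_ dA] _ _ [_ [hT uT _ _]] _] := fA.
have [] := chased_qr_step n0 dA rm1 ch; rewrite ?(eq_stored_Tk k T8) //.
set A1 := _ *m _ => qA1 fA1; exists m1, t1, A1; split=> //.
  by rewrite /run e.
exact: qr_step_proper qA1.
Qed.
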